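(* Let $\mathcal M=\mathbb R\times\mathcal N$ with structure $(\phi,\xi,\eta,g^L)$ be the Sasakian lift of a Kähler manifold $(\mathcal N,J,g)$ with Kähler form $\omega=d\tau$. Let $\nabla$ be the Levi-Civita connection of $g$ and $\bar\nabla$ that of $g^L$. For all vector fields $X,Y$ on $\mathcal N$, $$\bar\nabla_{X^L}\xi=-\phi X^L=-(JX)^L,$$ $$\bar\nabla_{X^L}Y^L=(\nabla_XY)^L-\Phi(X^L,Y^L)\,\xi.$$
   Context: Conventions: $2\,d\theta(X,Y)=X\theta(Y)-Y\theta(X)-\theta([X,Y])$ for a 1-form $\theta$. On a Kähler manifold $(\mathcal N,J,g)$, $\dim\mathcal N=2n$, the Kähler form is $\omega(X,Y)=g(X,JY)$; it is assumed that there is a global 1-form $\tau$ with $\omega=d\tau$. Sasakian lift: $\mathcal M=\mathbb R\times\mathcal N$ with projection $\pi_2:\mathcal M\to\mathcal N$ and coordinate $t$ on $\mathbb R$; $\xi=\partial_t$, $\eta=dt+\pi_2^*\tau$. A vector field $X$ on $\mathcal N$ is lifted to $X^L=X-(\tau(X)\circ\pi_2)\,\xi$ on $\mathcal M$. The $(1,1)$-tensor $\phi$ and metric $g^L$ are determined by $\phi X^L=(JX)^L$, $\phi\xi=0$, $g^L=\eta\otimes\eta+\pi_2^*g$. This structure is Sasakian, with fundamental form $\Phi(\cdot,\cdot)=g^L(\cdot,\phi\,\cdot)=d\eta$. *)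

(* Defs.v *)
From HB Require Import structures.
From mathcomp Require Import all_boot all_order all_algebra.
From mathcomp Require Import all_classical all_reals all_analysis.
From mathcomp Require Import ring.

Set Implicit Arguments.
Unset Strict Implicit.
Unset Printing Implicit Defensive.

Import Order.TTheory GRing.Theory Num.Theory.
Import numFieldNormedType.Exports.

Local Open Scope classical_set_scope.
Local Open Scope ring_scope.

Section SmoothRn.
Context {R : realType} {m : nat}.
Implicit Types (U V : set 'rV[R]_m) (f g : 'rV[R]_m -> R).

(* [f] has continuous partial derivatives up to order [k] at every point of
   [U]; only meant for open [U]. *)
Fixpoint Ck (k : nat) U f : Prop :=
  (forall x, U x -> {for x, continuous f}) /\
  if k is k'.+1 then
    forall i : 'I_m, (forall x, U x -> derivable f x (delta_mx 0 i)) /\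
                     Ck k' U (fun x => 'D_(delta_mx 0 i) f x)
  else True.

Definition smooth_in U f := forall k, Ck k U f.

Lemma Ck_sub k U V f : V `<=` U -> Ck k U f -> Ck k V f.
Proof.
move=> VU; elim: k f => [|k IH] f /= [cf H]; split; do ?by move=> x /VU; exact: cf.
  by [].
by move=> i; have [d1 d2] := H i; split; [move=> x /VU; exact: d1|exact: IH].
Qed.

Lemma CkS k U f : Ck k.+1 U f -> Ck k U f.
Proof.
elim: k f => [|k IH] f [cf H]; split=> // i; have [d1 d2] := H i.
by split => //; exact: IH.
Qed.

Lemma Ck_eq k U f g : open U -> (forall x, U x -> f x = g x) ->
  Ck k U f -> Ck k U g.
Proof.
move=> oU; elim: k f g => [|k IH] f g fg /= [cf H].
  split=> // x Ux.
  have nfg : \forall y \near x, f y = g y.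
    by near=> y; apply: fg; near: y; exact: open_nbhs_nbhs.
  rewrite /prop_for /continuous_at -(fg _ Ux).
  exact: (cvg_trans (near_eq_cvg nfg) (cf _ Ux)).
have nfg x : U x -> \forall y \near x, f y = g y.
  by move=> Ux; near=> y; apply: fg; near: y; exact: open_nbhs_nbhs.
split=> [x Ux|i].
  rewrite /prop_for /continuous_at -(fg _ Ux).
  exact: (cvg_trans (near_eq_cvg (nfg _ Ux)) (cf _ Ux)).
have [d1 d2] := H i; split=> [x Ux|].
  exact: near_eq_derivable (nfg _ Ux) (d1 _ Ux).
apply: (IH (fun x => 'D_(delta_mx 0 i) f x)) => // x Ux.
exact: near_eq_derive (nfg _ Ux).
Unshelve. all: by end_near. Qed.

Lemma Ck_cst k U (a : R) : Ck k U (fun=> a).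
Proof.
elim: k a => [|k IH] a /=; split=> //; do ?by move=> x _; exact: cst_continuous.
move=> i; split=> [x _|]; first exact: derivable_cst.
have -> : (fun x => 'D_(delta_mx 0 i) (fun=> a) x) = (fun=> 0 : R) :> ('rV[R]_m -> R).
  by apply/funext => x; exact: derive_cst.
exact: IH.
Qed.

Lemma CkD k U f g : open U -> Ck k U f -> Ck k U g ->
  Ck k U (fun x => f x + g x).
Proof.
move=> oU; elim: k f g => [|k IH] f g /= [cf Hf] [cg Hg].
  by split=> // x Ux; exact: (continuousD (cf _ Ux) (cg _ Ux)).
split=> [x Ux|i]; first by exact: (continuousD (cf _ Ux) (cg _ Ux)).
have [df1 df2] := Hf i; have [dg1 dg2] := Hg i; split=> [x Ux|].
  by apply: derivableD; [exact: df1|exact: dg1].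
apply: Ck_eq (IH _ _ df2 dg2) => // x Ux.
by rewrite -deriveD //; [exact: df1|exact: dg1].
Qed.

Lemma CkM k U f g : open U -> Ck k U f -> Ck k U g ->
  Ck k U (fun x => f x * g x).
Proof.
move=> oU; elim: k f g => [|k IH] f g Cf Cg.
  case: Cf Cg => [cf _] [cg _]; split=> // x Ux.
  by exact: (continuousM (cf _ Ux) (cg _ Ux)).
have := CkS Cg; have := CkS Cf; move=> Cf' Cg'.
case: Cf Cg => [cf Hf] [cg Hg].
split=> [x Ux|i]; first by exact: (continuousM (cf _ Ux) (cg _ Ux)).
have [df1 df2] := Hf i; have [dg1 dg2] := Hg i; split=> [x Ux|].
  by apply: derivableM; [exact: df1|exact: dg1].
have := CkD oU (IH _ _ Cf' dg2) (IH _ _ Cg' df2).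
apply: Ck_eq => // x Ux.
by rewrite deriveM //; [exact: df1|exact: dg1].
Qed.

Lemma Ck_coord k U j : Ck k U (fun x => x 0 j).
Proof.
have dq (x : 'rV[R]_m) i :
    (fun h : R => h^-1 *: (((fun x : 'rV[R]_m => x 0 j) \o shift x)
                             (h *: delta_mx 0 i) - x 0 j)) =
    (fun h : R => h^-1 * h * (i == j)%:R).
  by apply/funext => h /=; rewrite !mxE eqxx /= addrK -[LHS]/(_ * _) mulrA (eq_sym j).
have dl (b : R) : (h^-1 * h * b) @[h --> (0 : R)^'] --> b.
  apply: cvg_near_cst; near=> h; rewrite mulVf ?mul1r //.
  by near: h; exact: nbhs_dnbhs_neq.
case: k => [|k] /=; split=> //; do ?by move=> x _; exact: coord_continuous.
move=> i; split=> [x _|].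
  by rewrite /derivable dq; apply/cvg_ex; eexists; exact: dl.
have -> : (fun x => 'D_(delta_mx 0 i) (fun x : 'rV[R]_m => x 0 j) x) =
          (fun=> (i == j)%:R).
  by apply/funext => x; rewrite /derive dq; apply/cvg_lim => //; exact: dl.
exact: Ck_cst.
Unshelve. all: by end_near. Qed.

End SmoothRn.

Section AffineComp.
Context {R : realType} {m l : nat}.

Lemma Ck_comp_coord k (L : 'rV[R]_m -> 'rV[R]_l) U V (f : 'rV[R]_l -> R) :
  continuous L -> (forall x, U x -> V (L x)) ->
  (forall i, (forall x h, L (h *: delta_mx 0 i + x) = L x) \/
     exists j, forall x h, L (h *: delta_mx 0 i + x) = h *: delta_mx 0 j + L x) ->
  Ck k V f -> Ck k U (f \o L).
Proof.
move=> cL UV HL; elim: k f => [|k IH] f /= [cf H].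
  by split=> // x Ux; apply: continuous_comp; [exact: cL|exact/cf/UV].
split=> [x Ux|i].
  by apply: continuous_comp; [exact: cL|exact/cf/UV].
case: (HL i) => [L0|[j Lj]].
  have q0 x : (fun h : R => h^-1 *: ((f \o L \o shift x) (h *: delta_mx 0 i) -
                                   (f \o L) x)) = fun=> 0.
    by apply/funext => h /=; rewrite L0 subrr scaler0.
  split=> [x _|]; first by rewrite /derivable q0; exact: is_cvg_cst.
  have -> : (fun x => 'D_(delta_mx 0 i) (f \o L) x) = (fun=> 0 : R).
    by apply/funext => x; rewrite /derive q0; exact: lim_cst.
  exact: Ck_cst.
have qj x : (fun h : R => h^-1 *: ((f \o L \o shift x) (h *: delta_mx 0 i) -
                                 (f \o L) x)) =
    (fun h : R => h^-1 *: ((f \o shift (L x)) (h *: delta_mx 0 j) - f (L x))).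
  by apply/funext => h /=; rewrite Lj.
have [d1 d2] := H j; split=> [x Ux|].
  by rewrite /derivable qj; exact/d1/UV.
have -> : (fun x => 'D_(delta_mx 0 i) (f \o L) x) =
          (fun y => 'D_(delta_mx 0 j) f y) \o L.
  by apply/funext => x; rewrite /= /derive qj.
exact: IH.
Qed.

End AffineComp.
Section Manifold.
Context {R : realType} {m : nat}.

(* [coord] and [param] are only meaningful on [dom] and on its image. *)
Record chart (N : topologicalType) := Chart {
  dom : set N;
  coord :> N -> 'rV[R]_m;
  param : 'rV[R]_m -> N;
  dom_open : open dom;
  coord_open : open (coord @` dom);
  coordK : forall p, dom p -> param (coord p) = p;
  coord_cont : forall p, dom p -> {for p, continuous coord};
  param_cont : forall x, (coord @` dom) x -> {for x, continuous param} }.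

Definition smooth_transition (N : topologicalType) (c d : chart N) :=
  forall i, smooth_in (c @` (dom c `&` dom d)) (fun x => d (param c x) 0 i).

Lemma chart_image_open (N : topologicalType) (c : chart N) (U : set N) :
  open U -> open (c @` (U `&` dom c)).
Proof.
move=> oU; have -> : c @` (U `&` dom c) = c @` dom c `&` param c @^-1` U.
  apply/seteqP; split=> x /= [].
    by move=> p [Up cp] <-; split; [exists p|rewrite coordK].
  by move=> [p cp <-]; rewrite coordK // => Up; exists p.
rewrite openE => x [cx Ux]; apply: filterI.
  by apply: open_nbhs_nbhs; split => //; exact: coord_open.
by apply: (param_cont cx); apply: open_nbhs_nbhs.
Qed.

End Manifold.
Arguments chart : clear implicits.

(* Hausdorff and second countability are not part of this record. *)
Record manifold (R : realType) (m : nat) := Manifold {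
  carrier :> topologicalType;
  atlas : set (chart R m carrier);
  atlas_cover : forall p, exists2 c, atlas c & dom c p;
  atlas_compat : forall c d, atlas c -> atlas d -> smooth_transition c d }.
Arguments atlas {R m} _.

Section Smooth.
Context {R : realType} {m : nat} {N : manifold R m}.
Implicit Types (U V : set N) (f g : N -> R) (p : N).

Definition smooth_on U f := forall c, atlas N c ->
  smooth_in (c @` (U `&` dom c)) (f \o param c).

Definition smooth_near p f := exists U, [/\ open U, U p & smooth_on U f].

Lemma smooth_on_sub U V f : V `<=` U -> smooth_on U f -> smooth_on V f.
Proof.
move=> VU sf c ac k; apply: Ck_sub (sf c ac k).
by move=> _ [p [Vp cp] <-]; exists p => //; split => //; exact: VU.
Qed.

Lemma smooth_on_eq U f g : open U -> (forall p, U p -> f p = g p) ->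
  smooth_on U f -> smooth_on U g.
Proof.
move=> oU fg sf c ac k; apply: Ck_eq (sf c ac k); first exact: chart_image_open.
by move=> _ [p [Up cp] <-] /=; rewrite coordK //; exact: fg.
Qed.

Lemma smooth_on_cst U (a : R) : smooth_on U (fun=> a).
Proof. by move=> c ac k; exact: Ck_cst. Qed.

Lemma smooth_onD U f g : open U -> smooth_on U f -> smooth_on U g ->
  smooth_on U (fun p => f p + g p).
Proof.
by move=> oU sf sg c ac k; apply: CkD; [exact: chart_image_open|exact: sf|exact: sg].
Qed.

Lemma smooth_onM U f g : open U -> smooth_on U f -> smooth_on U g ->
  smooth_on U (fun p => f p * g p).
Proof.
by move=> oU sf sg c ac k; apply: CkM; [exact: chart_image_open|exact: sf|exact: sg].
Qed.

Lemma smooth_near2 p f g : smooth_near p f -> smooth_near p g ->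
  exists U, [/\ open U, U p, smooth_on U f & smooth_on U g].
Proof.
move=> [U [oU Up sf]] [V [oV Vp sg]]; exists (U `&` V); split.
- exact: openI.
- by [].
- by apply: smooth_on_sub sf => q [].
- by apply: smooth_on_sub sg => q [].
Qed.

Lemma smooth_near_cst p (a : R) : smooth_near p (fun=> a).
Proof. by exists setT; split => //; [exact: openT|exact: smooth_on_cst]. Qed.

Lemma smooth_nearD p f g : smooth_near p f -> smooth_near p g ->
  smooth_near p (fun q => f q + g q).
Proof.
move=> sf sg; have [U [oU Up {}sf {}sg]] := smooth_near2 sf sg.
by exists U; split => //; exact: smooth_onD.
Qed.

Lemma smooth_nearM p f g : smooth_near p f -> smooth_near p g ->
  smooth_near p (fun q => f q * g q).
Proof.
move=> sf sg; have [U [oU Up {}sf {}sg]] := smooth_near2 sf sg.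
by exists U; split => //; exact: smooth_onM.
Qed.

Lemma smooth_nearZ p (a : R) f : smooth_near p f ->
  smooth_near p (fun q => a * f q).
Proof. by move=> sf; apply: smooth_nearM => //; exact: smooth_near_cst. Qed.

Definition derivation p (v : (N -> R) -> R) :=
  [/\ forall f g, smooth_near p f -> smooth_near p g ->
        (\forall q \near p, f q = g q) -> v f = v g,
      forall a f g, smooth_near p f -> smooth_near p g ->
        v (fun q => a * f q + g q) = a * v f + v g
    & forall f g, smooth_near p f -> smooth_near p g ->
        v (fun q => f q * g q) = f p * v g + g p * v f].

(* A tangent vector is a derivation of the algebra of germs at [p] of smooth
   functions; since it is encoded as a functional on all functions, it is
   normalised to 0 on those that are not smooth near [p], so that two tangent
   vectors are equal as soon as they agree on germs. *)
Definition tangent_pred p : {pred (N -> R) -> R^o} := fun v =>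
  `[< derivation p v /\ forall f, ~ smooth_near p f -> v f = 0 >].

Lemma tangent_submod p : submod_closed (tangent_pred p).
Proof.
split=> [|a u v /asboolP[[u1 u2 u3] u0] /asboolP[[v1 v2 v3] v0]].
  by apply/asboolP; split => //; split=> *; rewrite /= ?mulr0 ?addr0.
have uvE h : (a *: u + v) h = a * u h + v h :> R by [].
apply/asboolP; split; last by move=> f nf; rewrite uvE u0 // v0 // mulr0 addr0.
split=> [f g sf sg fg|b f g sf sg|f g sf sg]; rewrite !uvE.
- by rewrite (u1 f g) // (v1 f g).
- by rewrite u2 // v2 //; ring.
- by rewrite u3 // v3 //; ring.
Qed.

HB.instance Definition _ p :=
  GRing.isSubmodClosed.Build R ((N -> R) -> R^o) (tangent_pred p)
    (tangent_submod p).

Record tangent p := Tangent {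
  tangent_fun :> (N -> R) -> R^o;
  tangentP : tangent_fun \in tangent_pred p }.

HB.instance Definition _ p := [isSub for @tangent_fun p].
HB.instance Definition _ p := [Choice of tangent p by <:].
HB.instance Definition _ p :=
  [SubChoice_isSubLmodule of tangent p by <:].

End Smooth.

Section VectorFields.
Context {R : realType} {m : nat} {N : manifold R m}.

(* The tangent vector at [p] acting as [F] on germs, provided [F] is a
   derivation; 0 otherwise. *)
Definition tangent_of (p : N) (F : (N -> R) -> R) : tangent p :=
  insubd 0 (fun f => if `[< smooth_near p f >] then F f else 0).

Lemma tangent_ofE (p : N) F f :
  derivation p F -> smooth_near p f -> tangent_of p F f = F f :> R.
Proof.
move=> [F1 F2 F3] sf; rewrite /tangent_of.
rewrite -[LHS]/(val (insubd _ _) f) insubdK; first by rewrite asboolT.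
apply/asboolP; split; last by move=> g ng; rewrite asboolF.
have := smooth_nearM; have := smooth_nearZ; have := smooth_nearD.
split=> [g h sg sh gh|a g h sg sh|g h sg sh]; rewrite !asboolT; auto.
Qed.

Lemma tangent_derivation (p : N) (v : tangent p) : derivation p v.
Proof. by have /asboolP[] := tangentP v. Qed.

Lemma tangent_eq (p : N) (v w : tangent p) :
  (forall f, smooth_near p f -> v f = w f) -> v = w.
Proof.
move=> vw; apply: val_inj; apply/funext => f /=.
have [sf|nf] := pselect (smooth_near p f); first exact: vw.
have /asboolP[_ v0] := tangentP v; have /asboolP[_ w0] := tangentP w.
by rewrite v0 // w0.
Qed.

Lemma tangent_cst (p : N) (v : tangent p) (a : R) : v (fun=> a) = 0 :> R.
Proof.
have [_ v2 v3] := tangent_derivation v.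
have c b := smooth_near_cst p b.
have v0 : v (fun=> 0) = 0 :> R.
  by have := v3 _ _ (c 0) (c 0); rewrite !mul0r addr0.
have v1 : v (fun=> 1) = 0 :> R.
  have := v3 _ _ (c 1) (c 1); rewrite !mul1r.
  by move/esym/eqP; rewrite -subr_eq0 addrK => /eqP.
by have := v2 a _ _ (c 1) (c 0); rewrite v0 v1 mulr0 !addr0 mulr1.
Qed.

(* Vector fields as possibly non-smooth sections of the tangent bundle. *)
Definition vfield := forall p : N, tangent p.

Definition act (X : vfield) (f : N -> R) : N -> R := fun p => X p f.

Definition smooth_vfield_on (U : set N) (X : vfield) :=
  forall V f, open V -> V `<=` U -> smooth_on V f -> smooth_on V (act X f).

Definition smooth_vfield := smooth_vfield_on setT.

Definition bracket (X Y : vfield) : vfield := fun p =>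
  tangent_of p (fun f => X p (act Y f) - Y p (act X f)).

Lemma smooth_near_act X (p : N) f :
  smooth_vfield X -> smooth_near p f -> smooth_near p (act X f).
Proof. by move=> sX [U [oU Up sf]]; exists U; split => //; exact: sX. Qed.

Lemma bracket_derivation X Y (p : N) : smooth_vfield X -> smooth_vfield Y ->
  derivation p (fun f => X p (act Y f) - Y p (act X f)).
Proof.
have near_sm f : smooth_near p f -> \forall q \near p, smooth_near q f.
  move=> [U [oU Up sf]]; near=> q; exists U; split => //.
  by near: q; exact: open_nbhs_nbhs.
suff half X' Y' : smooth_vfield X' -> smooth_vfield Y' ->
  [/\ forall f g, smooth_near p f -> smooth_near p g ->
        (\forall q \near p, f q = g q) -> X' p (act Y' f) = X' p (act Y' g),
      forall a f g, smooth_near p f -> smooth_near p g ->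
        X' p (act Y' (fun q => a * f q + g q)) =
        a * X' p (act Y' f) + X' p (act Y' g) :> R
    & forall f g, smooth_near p f -> smooth_near p g ->
        X' p (act Y' (fun q => f q * g q)) =
        f p * X' p (act Y' g) + Y' p g * X' p f +
        (g p * X' p (act Y' f) + Y' p f * X' p g) :> R].
  move=> sX sY; have [a1 a2 a3] := half _ _ sX sY.
  have [b1 b2 b3] := half _ _ sY sX; split=> [f g sf sg fg|a f g sf sg|f g sf sg].
  - by rewrite (a1 f g) // (b1 f g).
  - by rewrite a2 // b2 //; ring.
  - by rewrite a3 // b3 //; ring.
move=> sX sY; have [X1 X2 X3] := tangent_derivation (X' p).
have sa f := @smooth_near_act Y' p f sY.
split=> [f g sf sg fg|a f g sf sg|f g sf sg].
- apply: X1; [exact: sa|exact: sa|].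
  have fgn : \forall q \near p, \forall r \near q, f r = g r.
    by apply: nbhs_interior fg.
  near=> q; have [Y1 _ _] := tangent_derivation (Y' q).
  apply: Y1; near: q => //; exact: near_sm.
- rewrite -(X2 _ _ _ (sa _ sf) (sa _ sg)).
  apply: X1; first exact/sa/smooth_nearD/sg/smooth_nearZ.
    by apply: smooth_nearD; [exact/smooth_nearZ/sa|exact: sa].
  near=> q; have [_ Y2 _] := tangent_derivation (Y' q).
  apply: Y2; near: q; exact: near_sm.
have e1 := X3 _ _ sf (sa _ sg); have e2 := X3 _ _ sg (sa _ sf).
have s1 := smooth_nearM sf (sa _ sg); have s2 := smooth_nearM sg (sa _ sf).
rewrite -e1 -e2.
have := X2 1 _ _ s1 s2; rewrite mul1r => <-.
apply: X1; first exact/sa/smooth_nearM.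
  by apply: smooth_nearD => //; exact: smooth_nearZ.
near=> q; rewrite mul1r; have [_ _ Y3] := tangent_derivation (Y' q).
apply: Y3; near: q; exact: near_sm.
Unshelve. all: by end_near. Qed.

Lemma bracketE X Y (p : N) f : smooth_vfield X -> smooth_vfield Y ->
  smooth_near p f -> bracket X Y p f = X p (act Y f) - Y p (act X f) :> R.
Proof. by move=> sX sY; apply: tangent_ofE; exact: bracket_derivation. Qed.

End VectorFields.
Arguments vfield {R m} N.

Section Geometry.
Context {R : realType} {m : nat}.

(* Smoothness of tensor fields is tested on local smooth vector fields. *)
Record one_form (N : manifold R m) := OneForm {
  form_at :> forall p : N, {linear tangent p -> R^o};
  form_smooth : forall U X, open U -> smooth_vfield_on U X ->
    smooth_on U (fun p => form_at p (X p)) }.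

Record endo_field (N : manifold R m) := EndoField {
  endo_at :> forall p : N, {linear tangent p -> tangent p};
  endo_smooth : forall U X, open U -> smooth_vfield_on U X ->
    smooth_vfield_on U (fun p => endo_at p (X p)) }.

Definition tensor2 (N : manifold R m) :=
  forall p : N, tangent p -> tangent p -> R.

Context {N : manifold R m}.

Record riemannian (g : tensor2 N) : Prop := Riemannian {
  metric_lin : forall p a u v w, g p (a *: u + v) w = a * g p u w + g p v w;
  metric_sym : forall p u v, g p u v = g p v u;
  metric_pos : forall p u, u != 0 -> 0 < g p u u;
  metric_smooth : forall U X Y, open U ->
    smooth_vfield_on U X -> smooth_vfield_on U Y ->
    smooth_on U (fun p => g p (X p) (Y p)) }.

(* The exterior derivative normalised by
   2 dtheta(X, Y) = X(theta Y) - Y(theta X) - theta [X, Y]. *)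
Definition ext_d (theta : forall p : N, tangent p -> R) (X Y : vfield N) p : R :=
  2^-1 * (X p (fun q => theta q (Y q)) - Y p (fun q => theta q (X q))
          - theta p (bracket X Y p)).

(* The 2-form associated with a metric and a (1,1)-tensor field. *)
Definition fundamental_form (g : tensor2 N)
    (phi : forall p : N, tangent p -> tangent p) : tensor2 N :=
  fun p u v => g p u (phi p v).

(* The six-term formula for the exterior derivative of a 2-form, whose overall
   factor is irrelevant here. *)
Definition closed_form (w : tensor2 N) := forall X Y Z : vfield N,
  smooth_vfield X -> smooth_vfield Y -> smooth_vfield Z -> forall p : N,
  X p (fun q => w q (Y q) (Z q)) + Y p (fun q => w q (Z q) (X q))
  + Z p (fun q => w q (X q) (Y q))
  - w p (bracket X Y p) (Z p) - w p (bracket Y Z p) (X p)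
  - w p (bracket Z X p) (Y p) = 0 :> R.

Record levi_civita (g : tensor2 N) (D : vfield N -> vfield N -> vfield N)
    : Prop := LeviCivita {
  lc_smooth : forall X Y, smooth_vfield X -> smooth_vfield Y ->
    smooth_vfield (D X Y);
  lc_addl : forall X Y Z, smooth_vfield X -> smooth_vfield Y ->
    smooth_vfield Z -> forall p, D (fun q => X q + Y q) Z p = D X Z p + D Y Z p;
  lc_scalel : forall f X Y, smooth_on setT f -> smooth_vfield X ->
    smooth_vfield Y -> forall p, D (fun q => f q *: X q) Y p = f p *: D X Y p;
  lc_addr : forall X Y Z, smooth_vfield X -> smooth_vfield Y ->
    smooth_vfield Z -> forall p, D X (fun q => Y q + Z q) p = D X Y p + D X Z p;
  lc_leibniz : forall f X Y, smooth_on setT f -> smooth_vfield X ->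
    smooth_vfield Y -> forall p,
    D X (fun q => f q *: Y q) p = X p f *: Y p + f p *: D X Y p;
  lc_torsion_free : forall X Y, smooth_vfield X -> smooth_vfield Y ->
    forall p, D X Y p - D Y X p = bracket X Y p;
  lc_metric : forall X Y Z, smooth_vfield X -> smooth_vfield Y ->
    smooth_vfield Z -> forall p,
    X p (fun q => g q (Y q) (Z q)) = g p (D X Y p) (Z p) + g p (Y p) (D X Z p) }.

End Geometry.
Arguments fundamental_form {R m N} g phi p u v.
Arguments ext_d {R m N} theta X Y p.

Section Kaehler.
Context {R : realType} {n : nat} {N : manifold R (n + n)}.

(* [c] = (x_1, ..., x_n, y_1, ..., y_n) is a smooth chart whose functions
   x_k + i y_k are complex coordinates for [J]: dx_k \o J = - dy_k and
   dy_k \o J = dx_k, that is, J d/dx_k = d/dy_k and J d/dy_k = - d/dx_k. *)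
Definition complex_chart (J : endo_field N) (c : chart R (n + n) N) :=
  (forall d, atlas N d -> smooth_transition c d /\ smooth_transition d c) /\
  forall q (v : tangent q) (k : 'I_n), dom c q ->
    let x := fun r => c r 0 (lshift n k) in
    let y := fun r => c r 0 (rshift n k) in
    J q v x = - v y /\ J q v y = v x.

Record kaehler (J : endo_field N) (g : tensor2 N) : Prop := Kaehler {
  kaehler_J2 : forall p (v : tangent p), J p (J p v) = - v;
  kaehler_complex : forall p : N, exists2 c, complex_chart J c & dom c p;
  kaehler_metric : riemannian g;
  kaehler_hermitian : forall p u v, g p (J p u) (J p v) = g p u v;
  kaehler_closed : closed_form (fundamental_form g (fun p => J p)) }.

End Kaehler.

Lemma continuous_rV (R : realType) (T : topologicalType) k (F : T -> 'rV[R]_k) q :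
  (forall j, {for q, continuous (fun r => F r 0 j)}) -> {for q, continuous F}.
Proof.
move=> cF A [B nB BA].
apply: (@filterS _ (nbhs q) _ (fun r => forall i j, B i j (F r i j))).
  by move=> r Br; exact: BA.
apply: filter_forall => i; apply: filter_forall => j.
by have := nB i j; rewrite (ord1 i) => /cF.
Qed.

Section Product.
Context {R : realType} {m : nat} (N : manifold R m).

Definition prod_coord (c : N -> 'rV[R]_m) (q : R * N) : 'rV[R]_(1 + m) :=
  row_mx q.1%:M (c q.2).
Definition prod_param (c : 'rV[R]_m -> N) (x : 'rV[R]_(1 + m)) : R * N :=
  (x 0 (lshift m 0), c (rsubmx x)).

Lemma prod_coord_image (c : chart R m N) :
  prod_coord c @` (snd @^-1` dom c) = rsubmx @^-1` (c @` dom c).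
Proof.
apply/seteqP; split=> [_ [q cq <-]|x [p cp cpx]] /=.
  by exists q.2 => //; rewrite /prod_coord row_mxKr.
exists (x 0 (lshift m 0), p) => //=; rewrite /prod_coord /= cpx -[RHS]hsubmxK.
by congr row_mx; apply/rowP => i; rewrite !mxE ord1 eqxx mulr1n.
Qed.

Lemma prod_dom_open (c : chart R m N) : open ((@snd R N) @^-1` dom c).
Proof.
apply: open_comp; last exact: dom_open.
by move=> q _; exact: cvg_snd.
Qed.

Lemma prod_coord_open (c : chart R m N) :
  open (prod_coord c @` ((@snd R N) @^-1` dom c)).
Proof.
rewrite prod_coord_image; apply: open_comp; last exact: coord_open.
by move=> x _; exact: continuous_rsubmx.
Qed.

Lemma prod_coordK (c : chart R m N) (q : R * N) :
  (snd @^-1` dom c) q -> prod_param (param c) (prod_coord c q) = q.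
Proof.
case: q => t p /= cp; rewrite /prod_param /prod_coord /= row_mxKr coordK //.
by rewrite row_mxEl mxE eqxx mulr1n.
Qed.

Lemma prod_coord_cont (c : chart R m N) (q : R * N) :
  (snd @^-1` dom c) q -> {for q, continuous (prod_coord c)}.
Proof.
move=> cq; apply: continuous_rV => j; rewrite /prod_coord.
have cs : {for q, continuous (c \o snd)}.
  by apply: continuous_comp; [exact: cvg_snd|exact: coord_cont].
case: (splitP j) => k jk.
  have -> : j = lshift m k by exact/val_inj.
  have -> : (fun r : R * N => row_mx r.1%:M (c r.2) 0 (lshift m k)) = fst.
    by apply/funext => r; rewrite row_mxEl mxE ord1 eqxx mulr1n.
  exact: cvg_fst.
have -> : j = rshift 1 k by exact/val_inj.
have -> : (fun r : R * N => row_mx r.1%:M (c r.2) 0 (rshift 1 k)) =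
    (fun x : 'rV[R]_m => x 0 k) \o (c \o snd).
  by apply/funext => r; rewrite row_mxEr.
by apply: (continuous_comp cs); exact: coord_continuous.
Qed.

Lemma prod_param_cont (c : chart R m N) (x : 'rV[R]_(1 + m)) :
  (prod_coord c @` (snd @^-1` dom c)) x -> {for x, continuous (prod_param (param c))}.
Proof.
rewrite prod_coord_image => cx.
have c1 : {for x, continuous (fun x : 'rV[R]_(1 + m) => x 0 (lshift m 0))}.
  exact: coord_continuous.
have c2 : {for x, continuous (param c \o rsubmx)}.
  by apply: continuous_comp; [exact: continuous_rsubmx|exact: param_cont].
exact: (cvg_pair c1 c2).
Qed.

Definition prod_chart (c : chart R m N) : chart R (1 + m) (R * N)%type :=
  Chart (@prod_dom_open c) (@prod_coord_open c) (@prod_coordK c)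
    (@prod_coord_cont c) (@prod_param_cont c).

Lemma rsubmx_step (i : 'I_(1 + m)) :
  (forall (x : 'rV[R]_(1 + m)) h, rsubmx (h *: delta_mx 0 i + x) = rsubmx x) \/
  exists j, forall (x : 'rV[R]_(1 + m)) h,
    rsubmx (h *: delta_mx 0 i + x) = h *: delta_mx 0 j + rsubmx x.
Proof.
case: (splitP i) => k ik; [left|right; exists k] => x h; apply/rowP => l;
  rewrite !mxE eqxx /= -!val_eqE /= ik.
  by rewrite ord1 /= mulr0 add0r.
by rewrite eqn_add2l.
Qed.

Lemma prod_transition (c d : chart R m N) :
  smooth_transition c d -> smooth_transition (prod_chart c) (prod_chart d).
Proof.
move=> cd i k; case: (splitP i) => j ij.
  have -> : i = lshift m j by exact/val_inj.
  rewrite [X in Ck _ _ X](_ : _ = (fun x : 'rV[R]_(1 + m) => x 0 (lshift m j))).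
    exact: Ck_coord.
  by apply/funext => x; rewrite /= /prod_coord /= row_mxEl mxE ord1 eqxx mulr1n.
have -> : i = rshift 1 j by exact/val_inj.
rewrite [X in Ck _ _ X](_ : _ = (fun y : 'rV[R]_m => d (param c y) 0 j) \o rsubmx); last first.
  by apply/funext => x; rewrite /= /prod_coord /= row_mxEr.
apply: Ck_comp_coord (cd j k); [exact: continuous_rsubmx| |exact: rsubmx_step].
by move=> _ [q [cq dq] <-]; exists q.2 => //=; rewrite /prod_coord row_mxKr.
Qed.

Lemma prod_cover (q : R * N) :
  exists2 c, (prod_chart @` atlas N) c & dom c q.
Proof.
by have [c ac cq] := atlas_cover q.2; exists (prod_chart c) => //; exists c.
Qed.

Lemma prod_compat c d : (prod_chart @` atlas N) c ->
  (prod_chart @` atlas N) d -> smooth_transition c d.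
Proof. by move=> [c' ac <-] [d' ad <-]; apply: prod_transition; exact: atlas_compat. Qed.

(* The product manifold R x N. *)
Definition line_prod : manifold R (1 + m) := Manifold prod_cover prod_compat.

End Product.

Section Lift.
Context {R : realType} {m : nat} {N : manifold R m}.
Notation M := (line_prod N).
Implicit Types q : R * N.

(* The differential of the second projection. *)
Definition push_snd q (V : tangent (N := M) q) : tangent q.2 :=
  tangent_of q.2 (fun h => V (h \o snd)).

(* The vector (0, v) of T_(t,p)(R x N) = R x T_p N. *)
Definition slice_vec q (v : tangent q.2) : tangent (N := M) q :=
  tangent_of (N := M) q (fun f => v (fun p => f (q.1, p))).

Definition xi : vfield M := fun q =>
  tangent_of (N := M) q (fun f => 'D_1 (fun s : R => f (s, q.2)) q.1).

Lemma smooth_near_snd q (h : N -> R) :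
  smooth_near q.2 h -> smooth_near (N := M) q (h \o snd).
Proof.
move=> [U [oU Up sh]]; exists (snd @^-1` U); split => //.
  by apply: open_comp oU => r _; exact: cvg_snd.
move=> _ [c ac <-] k; apply: Ck_comp_coord (sh c ac k).
- exact: continuous_rsubmx.
- by move=> _ [r [Ur cr] <-]; exists r.2 => //=; rewrite /prod_coord row_mxKr.
- exact: rsubmx_step.
Qed.

Lemma smooth_near_slice q (f : M -> R) :
  smooth_near (N := M) q f -> smooth_near q.2 (fun p => f (q.1, p)).
Proof.
move=> [U [oU Up sf]]; exists ((fun p => (q.1, p)) @^-1` U); split.
- apply: open_comp oU => r _.
  exact: (cvg_pair (cvg_cst q.1 (F := nbhs r)) (cvg_id (F := nbhs r))).
- by case: q Up {sf}.
move=> c ac k; have {}sf : Ck k (prod_chart c @` (U `&` dom (prod_chart c)))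
    (f \o prod_param (param c)) by apply: sf; exists c.
have -> : (fun p => f (q.1, p)) \o param c =
    (f \o prod_param (param c)) \o (fun x => row_mx q.1%:M x).
  apply/funext => x; rewrite /= /prod_param row_mxKr row_mxEl.
  by rewrite mxE eqxx mulr1n.
apply: Ck_comp_coord sf.
- move=> x; apply: continuous_rV => j; case: (splitP j) => i ij.
    have -> : j = lshift m i by exact/val_inj.
    have -> : (fun y : 'rV[R]_m => row_mx (@scalar_mx R 1 q.1) y 0 (lshift m i)) =
      (fun=> (@scalar_mx R 1 q.1) 0 i) by apply/funext => y; rewrite row_mxEl.
    exact: cst_continuous.
  have -> : j = rshift 1 i by exact/val_inj.
  have -> : (fun y : 'rV[R]_m => row_mx (@scalar_mx R 1 q.1) y 0 (rshift 1 i)) =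
    (fun y => y 0 i) by apply/funext => y; rewrite row_mxEr.
  exact: coord_continuous.
- by move=> _ [p [Up' cp] <-]; exists (q.1, p).
move=> i; right; exists (rshift 1 i) => x h; apply/rowP => j.
case: (splitP j) => l jl.
  have -> : j = lshift m l by exact/val_inj.
  by rewrite row_mxEl [RHS]mxE row_mxEl !mxE eq_lrshift mulr0 add0r.
have -> : j = rshift 1 l by exact/val_inj.
by rewrite row_mxEr [RHS]mxE row_mxEr !mxE eq_rshift.
Qed.

Lemma derivable_line q (f : M -> R) : smooth_near (N := M) q f ->
  derivable (fun s : R => f (s, q.2)) q.1 1.
Proof.
move=> [U [oU Up sf]]; have [c ac cp] := atlas_cover q.2.
have [_ /(_ (lshift m 0))[d1 _]] :
  Ck 1 (prod_chart c @` (U `&` dom (prod_chart c))) (f \o prod_param (param c)).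
  by apply: sf; exists c.
have {d1} : derivable (f \o prod_param (param c)) (prod_coord c q)
    (delta_mx 0 (lshift m 0)).
  by apply: d1; exists q => //; split => //; move: Up; case: (q).
have e : (fun h : R => h^-1 *:
      (((f \o prod_param (param c)) \o shift (prod_coord c q))
         (h *: delta_mx 0 (lshift m 0)) - (f \o prod_param (param c)) (prod_coord c q))) =
    (fun h : R => h^-1 *: (((fun s : R => f (s, q.2)) \o shift q.1) (h *: 1) - f (q.1, q.2))).
  apply/funext => h /=; congr (_ *: (f _ - f _)); last first.
    by rewrite [LHS](@prod_coordK _ _ _ c) //; case: (q).
  rewrite /prod_param mxE row_mxEl !mxE !eqxx /= mulr1n; congr (_, _).
  rewrite linearD linearZ /= /prod_coord row_mxKr.
  rewrite (_ : rsubmx _ = 0) ?scaler0 ?add0r ?coordK //.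
  by apply/rowP => i; rewrite !mxE eq_rlshift andbF.
by rewrite /derivable e.
Qed.

Lemma slice_cont (t : R) : continuous (fun p : N => (t, p)).
Proof.
move=> p; exact: (cvg_pair (cvg_cst t (F := nbhs p)) (cvg_id (F := nbhs p))).
Qed.

Lemma line_cont (p : N) : continuous (fun s : R => (s, p)).
Proof.
move=> s; exact: (cvg_pair (cvg_id (F := nbhs s)) (cvg_cst p (F := nbhs s))).
Qed.

Lemma push_sndE q (V : tangent (N := M) q) h :
  smooth_near q.2 h -> push_snd V h = V (h \o snd) :> R.
Proof.
apply: tangent_ofE; have [V1 V2 V3] := tangent_derivation V.
split=> [f g sf sg fg|a f g sf sg|f g sf sg].
- apply: V1; do ?exact: smooth_near_snd.
  have c2 : {for q, continuous (snd : R * N -> N)} by exact: cvg_snd.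
  exact: (c2 [set p | f p = g p] fg).
- exact: V2 (smooth_near_snd sf) (smooth_near_snd sg).
- exact: V3 (smooth_near_snd sf) (smooth_near_snd sg).
Qed.

Lemma slice_vecE q (v : tangent q.2) f : smooth_near (N := M) q f ->
  slice_vec v f = v (fun p => f (q.1, p)) :> R.
Proof.
apply: tangent_ofE; have [v1 v2 v3] := tangent_derivation v.
split=> [f' g sf sg fg|a f' g sf sg|f' g sf sg].
- apply: v1; do ?exact: smooth_near_slice.
  apply: (@slice_cont q.1 q.2 [set r | f' r = g r]).
  by case: (q) fg.
- exact: v2 (smooth_near_slice sf) (smooth_near_slice sg).
- have := v3 _ _ (smooth_near_slice sf) (smooth_near_slice sg).
  by case: (q) v {v1 v2 v3 sf sg}.
Qed.

Lemma xiE q f : smooth_near (N := M) q f ->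
  xi q f = 'D_1 (fun s : R => f (s, q.2)) q.1 :> R.
Proof.
apply: tangent_ofE; split=> [f' g sf sg fg|a f' g sf sg|f' g sf sg].
- apply: near_eq_derive; apply: (@line_cont q.2 q.1 [set r | f' r = g r]).
  by case: (q) fg.
- have df := derivable_line sf; have dg := derivable_line sg.
  rewrite -[LHS]/('D_1 (a *: (fun s => f' (s, q.2)) + (fun s => g (s, q.2))) q.1).
  by rewrite deriveD ?deriveZ //; exact: derivableZ.
- have df := derivable_line sf; have dg := derivable_line sg.
  by rewrite -[LHS]/('D_1 ((fun s => f' (s, q.2)) * (fun s => g (s, q.2))) q.1)
    deriveM //; case: (q).
Qed.

End Lift.
Arguments xi {R m N} p.

Section SasakianLift.
Context {R : realType} {m : nat} {N : manifold R m}.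
Variables (tau : one_form N) (J : endo_field N) (g : tensor2 N).
Notation M := (line_prod N).
Implicit Types q : R * N.

(* dt + pi_2^* tau, where t is [fst]. *)
Definition eta q (V : tangent (N := M) q) : R := V fst + tau q.2 (push_snd V).

(* The lift v^L = v - tau(v) xi of a tangent vector, resp. X^L of a vector
   field. *)
Definition lift_vec q (v : tangent q.2) : tangent (N := M) q :=
  slice_vec v - (tau q.2 v : R) *: xi q.

Definition lift_field (X : vfield N) : vfield M := fun q => lift_vec (X q.2).

(* The unique tensor with phi X^L = (J X)^L and phi xi = 0, see [phi_lift] and
   [phi_xi]. *)
Definition phi q (V : tangent (N := M) q) : tangent (N := M) q :=
  lift_vec (J q.2 (push_snd V)).

Definition g_lift : tensor2 M := fun q V W =>
  eta V * eta W + g (push_snd V) (push_snd W).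

Lemma smooth_near_fst q : smooth_near (N := M) q fst.
Proof.
exists setT; split => //; first exact: openT.
by move=> _ [c ac <-] k; exact: Ck_coord.
Qed.

Lemma push_sndP q a (V W : tangent (N := M) q) :
  push_snd (a *: V + W) = a *: push_snd V + push_snd W.
Proof.
apply: tangent_eq => h sh.
rewrite -[RHS]/(a * push_snd V h + push_snd W h : R) !push_sndE //.
Qed.

Lemma push_snd_slice q (v : tangent q.2) : push_snd (slice_vec v) = v.
Proof.
apply: tangent_eq => h sh; rewrite push_sndE // slice_vecE //.
exact: smooth_near_snd.
Qed.

Lemma push_snd_xi q : push_snd (xi (N := N) q) = 0.
Proof.
apply: tangent_eq => h sh; rewrite push_sndE // xiE; last exact: smooth_near_snd.
by rewrite -[LHS]/('D_1 (cst (h q.2) : R -> R) q.1) derive_cst.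
Qed.

Lemma push_snd_lift q (v : tangent q.2) : push_snd (lift_vec v) = v.
Proof.
rewrite /lift_vec addrC -scaleNr push_sndP push_snd_xi push_snd_slice.
by rewrite scaler0 add0r.
Qed.

Lemma eta_xi q : eta (xi q) = 1.
Proof.
rewrite /eta push_snd_xi linear0 addr0 xiE; last exact: smooth_near_fst.
exact: derive_id.
Qed.

Lemma eta_lift q (v : tangent q.2) : eta (lift_vec v) = 0.
Proof.
rewrite /eta push_snd_lift.
rewrite -[X in X + _]/(slice_vec v fst - tau q.2 v * xi q fst : R).
rewrite slice_vecE; last exact: smooth_near_fst.
rewrite xiE; last exact: smooth_near_fst.
have -> : 'D_1 (fun s : R => s) q.1 = 1 :> R by exact: derive_id.
by rewrite -[X in X - _]/(v (fun=> q.1) : R) tangent_cst mulr1 sub0r addNr.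
Qed.

Lemma phi_lift (X : vfield N) q :
  phi (lift_field X q) = lift_field (fun p => J p (X p)) q.
Proof. by rewrite /phi push_snd_lift. Qed.

Lemma phi_xi q : phi (xi q) = 0.
Proof.
rewrite /phi push_snd_xi /lift_vec !linear0 scale0r subr0.
apply: tangent_eq => f sf; rewrite slice_vecE //.
Qed.

End SasakianLift.
Arguments eta {R m N} tau {q} V.
Arguments lift_field {R m N} tau X p.
Arguments phi {R m N} tau J q V.
Arguments g_lift {R m N} tau g p u v.

(* Main.v *)
From HB Require Import structures.
Require Import Defs.
From mathcomp Require Import all_boot all_order all_algebra.
From mathcomp Require Import all_classical all_reals all_analysis.
From mathcomp Require Import ring lra.

Set Implicit Arguments.
Unset Strict Implicit.
Unset Printing Implicit Defensive.

Import Order.TTheory GRing.Theory Num.Theory.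
Import numFieldNormedType.Exports.

Local Open Scope classical_set_scope.
Local Open Scope ring_scope.

(* A tangent vector V of R x N is determined by eta(V) and by its projection to
   N, so both formulas are compared through these two components, which the
   Koszul formula computes. On lifts and xi all its terms are those of N, except
   that eta([X^L, Y^L]) = - 2 dtau(X, Y) = - 2 omega(X, Y), whereas [X^L, xi] = 0.
   The projection P of the unknown derivative is only known through g(P, Z) for
   smooth fields Z on N. No extension of tangent vectors is needed to conclude:
   the difference between the restriction of P to a slice {t} x N and its
   expected value is itself such a field Z, and then g(Z, Z) = 0.

   Tangent vectors being derivations of germs, the smoothness of X^L and the
   determination of V by its components rest on Hadamard's lemma: the germ of f
   at a is f(a) + sum_i (x_i - a_i) h_i(x), where
   h_i(x) = int_0^1 (d_i f)(a + s (x - a)) ds is smooth. *)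

(** * Differentiability of functions with continuous partial derivatives *)

Section Line.
Context {R : realType} {V : normedModType R}.
Implicit Types (f : V -> R) (y v : V).

(** The difference quotient of the one-variable function at [t] is literally that of [f] at
    [t *: v + y] along [v]. *)
Lemma is_derive_line f y v (t : R) : derivable f (t *: v + y) v ->
  is_derive t 1 (fun s : R => f (s *: v + y)) ('D_v f (t *: v + y)).
Proof.
have e : (fun h : R => h^-1 *: (((fun s : R => f (s *: v + y)) \o shift t) (h *: 1)
      - f (t *: v + y))) =
    (fun h : R => h^-1 *: ((f \o shift (t *: v + y)) (h *: v) - f (t *: v + y))).
  by apply/funext => h /=; rewrite [h%:A]mulr1 scalerDl addrA.
by move=> df; split; rewrite /derivable /derive e.
Qed.

Lemma is_derive_line0 f y v (d : R) :
  is_derive (0 : R) 1 (fun s : R => f (s *: v + y)) d -> is_derive y v f d.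
Proof.
move=> [df0 <-]; have df : derivable f y v by exact/derivable1P.
split=> //.
have := @is_derive_line f y v 0.
by rewrite scale0r add0r => /(_ df)[_ <-].
Qed.

(** This is the one-variable mean value theorem on [0, h] or [h, 0]. Since the sign of [h] is
    arbitrary, the intermediate point is located only by its absolute value. *)
Lemma MVT_line f y v (h : R) :
  (forall t : R, `|t| <= `|h| -> derivable f (t *: v + y) v) ->
  exists2 t, `|t| <= `|h| & f (h *: v + y) - f y = h * 'D_v f (t *: v + y).
Proof.
pose phi t := f (t *: v + y); move=> df.
have f0 : f y = phi 0 by rewrite /phi scale0r add0r.
have dphi (t : R) : `|t| <= `|h| -> is_derive t 1 phi ('D_v f (t *: v + y)).
  by move=> th; apply: is_derive_line; exact: df.
have cphi (a b : R) : `|a| <= `|h| -> `|b| <= `|h| ->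
    {within `[a, b], continuous phi}.
  move=> ah bh; apply: derivable_within_continuous => t; rewrite in_itv /= => tab.
  apply: (@ex_derive _ _ _ _ _ _ _ (dphi _ _)).
  by move: ah bh tab; rewrite !ler_norml => /andP[? ?] /andP[? ?] /andP[? ?]; lra.
have [h0|/ltW h0] := leP 0 h.
  have hE := ger0_norm h0.
  have [||c] := @MVT_segment R phi (fun t => 'D_v f (t *: v + y)) 0 h h0.
  - move=> t; rewrite in_itv /= => /andP[? ?]; apply: dphi.
    by rewrite hE ger0_norm ltW.
  - by apply: cphi; rewrite ?normr0.
  rewrite in_itv /= => /andP[c0 ch] e; exists c.
    by rewrite hE ger0_norm.
  by rewrite f0 -/(phi h) e subr0 mulrC.
have hE := ler0_norm h0.
have [|t|c] := @MVT_segment R phi (fun t => 'D_v f (t *: v + y)) h 0 h0.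
- move=> t; rewrite in_itv /= => /andP[? ?]; apply: dphi.
  by rewrite hE ler0_norm ?lerN2 ltW.
- by apply: cphi; rewrite ?normr0.
rewrite in_itv /= => /andP[ch c0] e; exists c.
  by rewrite hE ler0_norm ?lerN2.
by rewrite f0 -/(phi h) -[LHS]opprB e; ring.
Qed.

End Line.

(** The estimate is a little-o expansion with a continuous linear part, and uniqueness of the
    differential identifies that part with ['d f x]. *)
Lemma differentiable_approx (R : realType) (V W : normedModType R) (f : V -> W)
    (L : {linear V -> W}) (x : V) : continuous L ->
  (forall e : R, 0 < e -> \forall h \near (0 : V),
     `|f (h + x) - f x - L h| <= e * `|h|) ->
  differentiable f x /\ 'd f x = L :> (V -> W).
Proof.
move=> cL Lf; have eL : f \o shift x = cst (f x) + L +o_ 0 id.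
  apply/eqaddoP => e e0; have := Lf e e0.
  by apply: filterS => h; rewrite -addrA -opprD.
have dL : 'd f x = L :> (V -> W) by exact: diff_unique eL.
by split=> //; apply/diff_locallyP; rewrite dL.
Qed.

Section Gradient.
Context {R : realType} {m : nat}.
Implicit Types (U : set 'rV[R]_m) (f : 'rV[R]_m -> R) (x y h : 'rV[R]_m).

Definition lin_comb (a : 'I_m -> R) h : R := \sum_i h 0 i * a i.

Lemma lin_comb_linear a : linear (lin_comb a : 'rV[R]_m -> R^o).
Proof.
move=> k u v; rewrite /lin_comb scaler_sumr -big_split /=; apply: eq_bigr => i _.
by rewrite !mxE mulrDl -mulrA.
Qed.

HB.instance Definition _ a :=
  GRing.isLinear.Build R 'rV[R]_m R^o _ (lin_comb a) (@lin_comb_linear a).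

Lemma lin_comb_continuous a : continuous (lin_comb a).
Proof.
move=> x; rewrite /lin_comb; elim: (index_enum _) => [|i r IH].
  by under eq_fun do rewrite big_nil; exact: cst_continuous.
under eq_fun do rewrite big_cons.
apply: continuousD IH; apply: continuousM; first exact: coord_continuous.
exact: cst_continuous.
Qed.

Lemma coord_norm_le h i : `|h 0 i| <= `|h|.
Proof. by rewrite [leRHS]/Num.Def.normr/= mx_normrE; exact: (le_bigmax _ _ (0, i)). Qed.

(** The points [trunc k h + x] are the vertices of a path from [x] to [h + x] whose edges are
    parallel to the coordinate axes. *)
Definition trunc (k : nat) h : 'rV[R]_m := \row_i (if (i < k)%N then h 0 i else 0).

Lemma truncS (k : 'I_m) h : trunc k.+1 h = h 0 k *: delta_mx 0 k + trunc k h.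
Proof.
apply/rowP => i; rewrite !mxE eqxx /= ltnS.
have [->|ik] := eqVneq i k; first by rewrite leqnn ltnn mulr1 addr0.
by rewrite mulr0 add0r leq_eqVlt -[(_ == _ :> nat)]/(i == k) (negPf ik).
Qed.

Lemma trunc0 h : trunc 0 h = 0.
Proof. by apply/rowP => i; rewrite !mxE. Qed.

Lemma trunc_full h : trunc m h = h.
Proof. by apply/rowP => i; rewrite !mxE ltn_ord. Qed.

(** For the max norm, no coordinate of a point on the [k]-th edge exceeds [|h|], so the whole path
    stays in the ball where the partial derivatives are controlled. *)
Lemma trunc_step_lt (k : 'I_m) h (t e : R) : `|h| < e -> `|t| <= `|h 0 k| ->
  `|t *: delta_mx 0 k + trunc k h| < e.
Proof.
move=> he th; apply: le_lt_trans he.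
rewrite [leLHS]/Num.Def.normr /= mx_normrE; apply: bigmax_le => // -[j i] _ /=.
rewrite (ord1 j) !mxE eqxx /=.
have [->|ik] := eqVneq i k.
  by rewrite ltnn mulr1 addr0 (le_trans th) // coord_norm_le.
rewrite mulr0 add0r; case: ifP => _; first exact: coord_norm_le.
by rewrite normr0.
Qed.

(* Telescoping the increment of f over the coordinates, with the mean value
   theorem in each of them. *)
Lemma C1_increment U f x : open U -> U x ->
  (forall i y, U y -> derivable f y (delta_mx 0 i)) ->
  (forall i, {for x, continuous (fun y => 'D_(delta_mx 0 i) f y)}) ->
  forall e : R, 0 < e -> \forall h \near (0 : 'rV[R]_m),
    `|f (h + x) - f x - lin_comb (fun i => 'D_(delta_mx 0 i) f x) h| <=
    e * `|h|.
Proof.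
(* Each of the [m] edges will cost at most [e' * |h|]. Dividing by [m.+1] also covers [m = 0]. *)
move=> oU Ux df cf e e0; pose e' := e / m.+1%:R.
have e'0 : 0 < e' by rewrite divr_gt0.
have : \forall y \near x, U y /\
    forall i, `|'D_(delta_mx 0 i) f x - 'D_(delta_mx 0 i) f y| <= e'.
  have near_d : \forall y \near x,
      forall i, `|'D_(delta_mx 0 i) f x - 'D_(delta_mx 0 i) f y| <= e'.
    apply: (@filter_forall _ _ (fun i y =>
      `|'D_(delta_mx 0 i) f x - 'D_(delta_mx 0 i) f y| <= e') (nbhs x)) => i.
    by have /cvgrPdist_le/(_ _ e'0) := cf i.
  by near=> y; split; near: y => //; exact: open_nbhs_nbhs.
move=> /nbhs_normP[d /= d0 Hd]; apply/nbhs_normP; exists d => //= h.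
rewrite /= sub0r normrN => hd.
have Hstep (k : 'I_m) :
    `|f (trunc k.+1 h + x) - f (trunc k h + x) - h 0 k * 'D_(delta_mx 0 k) f x|
    <= e' * `|h|.
  have near_x (t : R) : `|t| <= `|h 0 k| ->
      `|x - (t *: delta_mx 0 k + (trunc k h + x))| < d.
    move=> th; rewrite distrC addrA addrK; exact: trunc_step_lt.
  have [|t th] := @MVT_line _ _ f (trunc k h + x) (delta_mx 0 k) (h 0 k).
    by move=> t th; apply: df; have [] := Hd _ (near_x _ th).
  rewrite truncS -[_ *: _ + _ + x]addrA => ->; rewrite -mulrBr normrM mulrC.
  apply: ler_pM => //; last exact: coord_norm_le.
  by rewrite distrC; have [_] := Hd _ (near_x _ th); exact.
have -> : f (h + x) - f x = \sum_(k < m) (f (trunc k.+1 h + x) - f (trunc k h + x)).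
  rewrite -(big_mkord xpredT (fun k => f (trunc k.+1 h + x) - f (trunc k h + x))).
  by rewrite telescope_sumr // trunc_full trunc0 add0r.
rewrite /lin_comb -sumrB; apply: le_trans (ler_norm_sum _ _ _) _.
apply: le_trans (ler_sum _ (fun k _ => Hstep k)) _.
rewrite sumr_const card_ord -mulr_natl mulrA ler_wpM2r //.
rewrite /e' mulrCA ler_piMr ?ltW // ltr_pdivrMr //.
by rewrite mul1r ltr_nat.
Unshelve. all: by end_near. Qed.

Lemma C1_diff U f x : open U -> U x ->
  (forall i y, U y -> derivable f y (delta_mx 0 i)) ->
  (forall i, {for x, continuous (fun y => 'D_(delta_mx 0 i) f y)}) ->
  differentiable f x /\
  'd f x = lin_comb (fun i => 'D_(delta_mx 0 i) f x) :> ('rV[R]_m -> R).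
Proof.
move=> oU Ux df cf.
apply: (@differentiable_approx R 'rV[R]_m R^o f
  (lin_comb (fun i => 'D_(delta_mx 0 i) f x))).
  exact: lin_comb_continuous.
exact: C1_increment oU Ux df cf.
Qed.

End Gradient.

(** * Locality of the C^k conditions and the chain rule *)

Section Smoothness.
Context {R : realType} {m : nat}.
Implicit Types (U V W : set 'rV[R]_m) (f : 'rV[R]_m -> R).

(** Every clause of [Ck] is a condition at single points of [U], so the neighbourhood [W] may vary
    with the point. *)
Lemma Ck_local k U f :
  (forall x, U x -> exists W, [/\ open W, W x & Ck k W f]) -> Ck k U f.
Proof.
elim: k f => [|k IH] f loc; split=> //.
- by move=> x /loc[W [_ Wx [cf _]]]; exact: cf.
- by move=> x /loc[W [_ Wx [cf _]]]; exact: cf.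
move=> i; split=> [x /loc[W [_ Wx [_ /(_ i)[+ _]]]]|]; first exact.
by apply: IH => x /loc[W [oW Wx [_ /(_ i)[_ ?]]]]; exists W.
Qed.

Lemma Ck_continuous k U f x : Ck k U f -> U x -> {for x, continuous f}.
Proof. by case: k => [|k] [cf _] /cf. Qed.

Lemma Ck_derivable k U f i x : Ck k.+1 U f -> U x ->
  derivable f x (delta_mx 0 i).
Proof. by move=> [_ /(_ i)[+ _]] Ux; exact. Qed.

Lemma Ck_partial k U f i : Ck k.+1 U f ->
  Ck k U (fun x => 'D_(delta_mx 0 i) f x).
Proof. by move=> [_ /(_ i)[]]. Qed.

Lemma Ck_sum k U l (f : 'I_l -> 'rV[R]_m -> R) : open U ->
  (forall j, Ck k U (f j)) -> Ck k U (fun x => \sum_j f j x).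
Proof.
move=> oU Cf; elim: (index_enum _) => [|j r IH].
  by under eq_fun do rewrite big_nil; exact: Ck_cst.
by under eq_fun do rewrite big_cons; exact: CkD.
Qed.

Lemma Ck_diff k U f x : open U -> Ck k.+1 U f -> U x ->
  differentiable f x /\
  'd f x = lin_comb (fun i => 'D_(delta_mx 0 i) f x) :> ('rV[R]_m -> R).
Proof.
move=> oU Cf Ux; apply: (C1_diff oU Ux) => [i y|i]; first exact: Ck_derivable Cf.
exact: (Ck_continuous (Ck_partial i Cf)).
Qed.

End Smoothness.

Section ChainRule.
Context {R : realType} {V : normedModType R} {l : nat}.
Implicit Types (L : V -> 'rV[R]_l) (f : 'rV[R]_l -> R).

(** The map [L] is followed only along the curve [c t = L (t *: v + x)]: in one variable
    derivability is differentiability, so the chain rule for differentials applies to [f \o c]. *)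
Lemma is_derive_comp L f (x v : V) (a : 'I_l -> R) : differentiable f (L x) ->
  'd f (L x) = lin_comb a :> ('rV[R]_l -> R) ->
  (forall j, derivable (fun y => L y 0 j) x v) ->
  is_derive x v (f \o L) (\sum_j 'D_v (fun y => L y 0 j) x * a j).
Proof.
move=> df dfE dL; pose c (t : R) := L (t *: v + x).
have c0 : c 0 = L x by rewrite /c scale0r add0r.
have dcj j : is_derive (0 : R) 1 (fun t => c t 0 j) ('D_v (fun y => L y 0 j) x).
  rewrite -[x in 'D_v _ x]add0r -(scale0r v); apply: (@is_derive_line _ _ (fun y => L y 0 j)).
  by rewrite scale0r add0r.
have dc : derivable c 0 1 by apply/derivable_mxP => i j; rewrite (ord1 i); have [] := dcj j.
have Dc : 'D_1 c 0 = \row_j 'D_v (fun y => L y 0 j) x.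
  by rewrite derive_mx //; apply/rowP => j; rewrite !mxE; have [_ ->] := dcj j.
have cdiff : differentiable c 0 by exact/derivable1_diffP.
have fdiff : differentiable f (c 0) by rewrite c0.
have fc : differentiable (f \o c) 0 by exact: differentiable_comp.
have fcE : 'D_1 (f \o c) 0 = \sum_j 'D_v (fun y => L y 0 j) x * a j.
  rewrite deriveE // diff_comp //= -(deriveE (1 : R) cdiff) c0 dfE Dc /lin_comb.
  by apply: eq_bigr => j _; rewrite mxE.
apply: is_derive_line0; rewrite -fcE; split=> //.
exact: diff_derivable.
Qed.

End ChainRule.

(** Induction on [k]: the chain rule writes a partial derivative of [f \o L] as a sum of products,
    in which the partial derivatives of [f] are again composed with [L]. Here [L] may be any C^k
    map, as chart transitions require. *)
Lemma Ck_comp (R : realType) (m l k : nat) (L : 'rV[R]_m -> 'rV[R]_l)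
    (U : set 'rV[R]_m) (V : set 'rV[R]_l) (f : 'rV[R]_l -> R) :
  open U -> open V -> (forall x, U x -> V (L x)) ->
  (forall j, Ck k U (fun x => L x 0 j)) -> Ck k V f -> Ck k U (f \o L).
Proof.
move=> oU oV UV; elim: k f => [|k IH] f CL Cf.
  split=> // x Ux; apply: continuous_comp; last exact: Ck_continuous Cf (UV _ Ux).
  by apply: continuous_rV => j; exact: Ck_continuous (CL j) Ux.
have D x i : U x -> is_derive x (delta_mx 0 i) (f \o L)
    (\sum_j 'D_(delta_mx 0 i) (fun y => L y 0 j) x * 'D_(delta_mx 0 j) f (L x)).
  move=> Ux; have [df dfE] := Ck_diff oV Cf (UV _ Ux).
  by apply: is_derive_comp => // j; exact: Ck_derivable (CL j) Ux.
split=> [x Ux|i].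
  apply: continuous_comp; last exact: Ck_continuous Cf (UV _ Ux).
  by apply: continuous_rV => j; exact: Ck_continuous (CL j) Ux.
split=> [x Ux|]; first by have [] := D x i Ux.
apply: (Ck_eq oU (f := fun x => \sum_j 'D_(delta_mx 0 i) (fun y => L y 0 j) x *
                                       'D_(delta_mx 0 j) f (L x))).
  by move=> x Ux; have [_ ->] := D x i Ux.
apply: Ck_sum => // j; apply: CkM => //; first exact: Ck_partial.
apply: (IH (fun y => 'D_(delta_mx 0 j) f y)); last exact: Ck_partial.
by move=> j'; exact: CkS.
Qed.

(** * Hadamard's lemma *)

Section UnitIntegral.
Context {R : realType}.
Local Notation mu := (@lebesgue_measure R).
Local Notation I01 := (`[0%R, 1%R]%classic).
Implicit Types phi psi : R -> R.

Lemma unit_within phi : (forall s : R, 0 <= s <= 1 -> {for s, continuous phi}) ->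
  {within I01, continuous phi}.
Proof.
move=> cphi; apply: continuous_in_subspaceT => s; rewrite inE /= in_itv /=.
exact: cphi.
Qed.

Lemma unit_integrable phi :
  (forall s : R, 0 <= s <= 1 -> {for s, continuous phi}) ->
  mu.-integrable I01 (EFin \o phi).
Proof.
move=> /unit_within; apply: continuous_compact_integrable.
exact: segment_compact.
Qed.

Lemma unit_bounded phi :
  (forall s : R, 0 <= s <= 1 -> {for s, continuous phi}) ->
  exists2 C : R, 0 <= C & forall s : R, 0 <= s <= 1 -> `|phi s| <= C.
Proof.
move=> /unit_within/continuous_compact/(_ (@segment_compact _ _ _)).
move=> /compact_bounded[M [_ HM]].
exists (`|M| + 1) => [|s s01]; first by rewrite addr_ge0.
apply: (HM (`|M| + 1)); first by rewrite (le_lt_trans (ler_norm _)) // ltrDl.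
by exists s => //=; rewrite in_itv.
Qed.

Lemma unit_dist phi psi (e : R) :
  (forall s : R, 0 <= s <= 1 -> {for s, continuous phi}) ->
  (forall s : R, 0 <= s <= 1 -> {for s, continuous psi}) ->
  (forall s : R, 0 <= s <= 1 -> `|phi s - psi s| <= e) ->
  `|\int[mu]_(s in I01) phi s - \int[mu]_(s in I01) psi s| <= e.
Proof.
move=> cphi cpsi H.
have iphi := unit_integrable cphi; have ipsi := unit_integrable cpsi.
have cB s : 0 <= s <= 1 -> {for s, continuous (fun t => phi t - psi t)}.
  by move=> s01; apply: continuousB; [exact: cphi|exact: cpsi].
have cN s : 0 <= s <= 1 -> {for s, continuous (fun t => `|phi t - psi t|)}.
  by move=> s01; apply: cvg_norm; exact: cB.
rewrite -RintegralB //.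
apply: (le_trans (le_normr_Rintegral _ _)) => //; first exact: unit_integrable.
have ce s : 0 <= s <= 1 -> {for s, continuous (fun _ : R => e)}.
  by move=> _; exact: cst_continuous.
apply: (@le_trans _ _ (\int[mu]_(s in I01) e)).
  apply: le_Rintegral => //; do ?exact: unit_integrable.
by rewrite Rintegral_cst //= lebesgue_measure_itv /= lte_fin ltr01 -EFinD subr0 /= mulr1.
Qed.

(** Tube lemma: compactness of [0, 1] turns continuity at each point [(s, x)] into an estimate
    uniform in [s]. *)
Lemma unit_tube (X : topologicalType) (phi : R -> X -> R) (x : X) (e : R) :
  0 < e ->
  (forall s : R, 0 <= s <= 1 ->
     {for (s, x), continuous (fun p : R * X => phi p.1 p.2)}) ->
  \forall y \near x, forall s : R, 0 <= s <= 1 -> `|phi s x - phi s y| <= e.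
Proof.
move=> e0 cphi.
have : \forall y \near x, I01 `<=` (fun s => `|phi s x - phi s y| <= e).
  apply: ((compact_near_coveringP _).1 (@segment_compact R 0 1) X (nbhs x)
    (fun y s => `|phi s x - phi s y| <= e)).
  move=> s /=; rewrite in_itv /= => s01.
  have e2 : 0 < e / 2 by rewrite divr_gt0.
  have /cvgrPdist_le/(_ _ e2) /= nc := cphi s s01.
  have [[A B] [/= nA nB] AB] := nc.
  exists (A, B) => // -[s' y] /= [As' By].
  (* Both [phi s' y] and [phi s' x] are within [e / 2] of [phi s x]. *)
  have h1 := AB (s', y) (conj As' By); have h2 := AB (s', x) (conj As' (nbhs_singleton nB)).
  rewrite (le_trans (ler_distD (phi s x) _ _)) // [e]splitr lerD // distrC //.
by apply: filterS => y Hy s s01; apply: Hy; rewrite /= in_itv.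
Qed.

End UnitIntegral.

(** * Smoothness of integrals along the segments issued from a point *)

Section SegmentIntegral.
Context {R : realType} {m : nat}.
Variables (a : 'rV[R]_m) (r : R).
Local Notation mu := (@lebesgue_measure R).
Local Notation B := (ball a r).
Implicit Types (g : 'rV[R]_m -> R) (x y : 'rV[R]_m).

Definition segment (s : R) x : 'rV[R]_m := s *: (x - a) + a.

(** The weight [s ^+ k] makes this family stable under partial derivatives: each differentiation in
    [x] brings out one factor [s] from [segment s x]. Hadamard's coefficients are the case
    [k = 0]. *)
Definition segment_int (k : nat) g x : R :=
  \int[mu]_(s in `[0%R, 1%R]) (s ^+ k * g (segment s x)).

Lemma segment_ball s x : 0 <= s <= 1 -> B x -> B (segment s x).
Proof.
rewrite -ball_normE /= => /andP[s0 s1] xa.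
rewrite /segment opprD addrCA subrr addr0 normrN normrZ ger0_norm //.
by rewrite distrC (le_lt_trans _ xa) // ler_piMl.
Qed.

Lemma segment_continuous s x :
  {for (s, x), continuous (fun p : R * 'rV[R]_m => segment p.1 p.2)}.
Proof.
apply: cvgD; last exact: cvg_cst.
apply: cvgZ; first exact: cvg_fst.
by apply: cvgB; [exact: cvg_snd|exact: cvg_cst].
Qed.

Lemma segment_int_cont k g s x : (forall y, B y -> {for y, continuous g}) ->
  0 <= s <= 1 -> B x ->
  {for (s, x), continuous (fun p : R * 'rV[R]_m => p.1 ^+ k * g (segment p.1 p.2))}.
Proof.
move=> cg s01 Bx; apply: cvgM.
  apply: (@continuous_comp _ _ _ fst (fun t : R => t ^+ k)); first exact: cvg_fst.
  exact: exprn_continuous.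
apply: (@continuous_comp _ _ _ (fun p : R * 'rV[R]_m => segment p.1 p.2) g).
  exact: segment_continuous.
by apply: cg; exact: segment_ball.
Qed.

Lemma segment_int_cont1 k g s x : (forall y, B y -> {for y, continuous g}) ->
  0 <= s <= 1 -> B x ->
  {for s, continuous (fun s : R => s ^+ k * g (segment s x))}.
Proof.
move=> cg s01 Bx.
apply: (@continuous_comp _ _ _ (fun t : R => (t, x))
  (fun p : R * 'rV[R]_m => p.1 ^+ k * g (segment p.1 p.2))).
  exact: (cvg_pair (cvg_id (F := nbhs s)) (cvg_cst x (F := nbhs s))).
exact: segment_int_cont.
Qed.

Lemma segment_int_continuous k g x : (forall y, B y -> {for y, continuous g}) ->
  B x -> {for x, continuous (segment_int k g)}.
Proof.
move=> cg Bx; apply/(cvgrPdist_le (F := nbhs x)) => e e0.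
have nB : \forall y \near x, B y.
  by apply: open_nbhs_nbhs; split => //; exact: ball_open.
have ct s : 0 <= s <= 1 -> {for (s, x), continuous
    (fun p : R * 'rV[R]_m => p.1 ^+ k * g (segment p.1 p.2))}.
  by move=> s01; exact: segment_int_cont.
have := unit_tube (phi := fun s y => s ^+ k * g (segment s y)) e0 ct.
move=> tube; near=> y; apply: unit_dist => [s s01|s s01|]; last by near: y.
  exact: segment_int_cont1.
by apply: segment_int_cont1 => //; near: y.
Unshelve. all: by end_near. Qed.

Lemma segment_line s x i (t : R) : segment s (t *: delta_mx 0 i + x) =
  (s * t) *: delta_mx 0 i + segment s x.
Proof. by rewrite /segment -addrA scalerDr scalerA addrA. Qed.

Lemma segment_partial k g s x i : derivable g (segment s x) (delta_mx 0 i) ->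
  is_derive x (delta_mx 0 i) (fun y => s ^+ k * g (segment s y))
    (s ^+ k.+1 * 'D_(delta_mx 0 i) g (segment s x)).
Proof.
move=> dg; apply: is_derive_line0.
have -> : (fun t : R => s ^+ k * g (segment s (t *: delta_mx 0 i + x))) =
    (s ^+ k) *: ((fun t : R => g (t *: delta_mx 0 i + segment s x)) \o (s *: id)).
  by apply/funext => t /=; rewrite segment_line.
have dphi : is_derive (s * 0) 1 (fun t : R => g (t *: delta_mx 0 i + segment s x))
    ('D_(delta_mx 0 i) g (segment s x)).
  have := @is_derive_line _ _ g (segment s x) (delta_mx 0 i) (s * 0).
  by rewrite mulr0 scale0r add0r; exact.
have dcomp := is_derive1_comp dphi (is_deriveZ s (is_derive_id (0 : R) (1 : R))).
apply: is_derive_eq (is_deriveZ _ dcomp) _.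
by rewrite -[LHS]/(s ^+ k * ('D_(delta_mx 0 i) g (segment s x) * (s * 1))) exprSr; ring.
Qed.

(** Differentiation under the integral sign, applied on the line through [x] in the direction of the
    [i]-th basis vector. *)
Lemma segment_int_partial k g x i : Ck 1 B g -> B x ->
  is_derive x (delta_mx 0 i) (segment_int k g)
    (segment_int k.+1 (fun y => 'D_(delta_mx 0 i) g y) x).
Proof.
move=> Cg Bx; set g' := fun y => 'D_(delta_mx 0 i) g y.
have cg y : B y -> {for y, continuous g} by exact: Ck_continuous Cg.
have cg' y : B y -> {for y, continuous g'} by exact: (Ck_continuous (Ck_partial i Cg)).
pose c (t : R) := t *: delta_mx 0 i + x.
have cc t : {for t, continuous c}.
  by apply: cvgD; [apply: cvgZr_tmp; exact: cvg_id|exact: cvg_cst].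
have c0 : c 0 = x by rewrite /c scale0r add0r.
(* [C] bounds the differentiated integrand at [x] itself. By [tube] it changes by at most 1 at
   points near [x], so the constant [C + 1] dominates it for [|t| < d]. *)
have [C C0 HC] := unit_bounded (fun (s : R) s01 => @segment_int_cont1 k.+1 _ s _ cg' s01 Bx).
have ct s : 0 <= s <= 1 -> {for (s, x), continuous
    (fun p : R * 'rV[R]_m => p.1 ^+ k.+1 * g' (segment p.1 p.2))}.
  by move=> s01; exact: segment_int_cont.
have tube := unit_tube (phi := fun s y => s ^+ k.+1 * g' (segment s y)) ltr01 ct.
have nB : \forall y \near x, B y.
  by apply: open_nbhs_nbhs; split => //; exact: ball_open.
have [d /= d0 Hd] : \forall t \near (0 : R), B (c t) /\ forall s : R, 0 <= s <= 1 ->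
    `|s ^+ k.+1 * g' (segment s x) - s ^+ k.+1 * g' (segment s (c t))| <= 1.
  have cx : c @ (0 : R) --> x by rewrite -[X in _ --> X]c0; exact: cc.
  exact: (cx _ (filterI nB tube)).
pose F t s := s ^+ k * g (segment s (c t)).
have inB t : `](- d), d[%classic t -> B (c t) /\ forall s : R, 0 <= s <= 1 ->
    `|s ^+ k.+1 * g' (segment s x) - s ^+ k.+1 * g' (segment s (c t))| <= 1.
  move=> /=; rewrite in_itv /= => td; apply: Hd.
  by rewrite /= sub0r normrN ltr_norml.
have dF t s : `](- d), d[%classic t -> 0 <= s <= 1 ->
    is_derive t 1 (F ^~ s) (s ^+ k.+1 * g' (segment s (c t))).
  move=> /inB[Bt _] s01.
  have [e1 e2] : is_derive (c t) (delta_mx 0 i) (fun y => s ^+ k * g (segment s y))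
    (s ^+ k.+1 * g' (segment s (c t))).
    by apply: segment_partial; apply: Ck_derivable Cg _; exact: segment_ball.
  by rewrite -e2; exact: (is_derive_line e1).
have I0 : `](- d), d[%classic (0 : R) by rewrite /= in_itv /= oppr_lt0 d0.
have intF t : `](- d), d[%classic t -> mu.-integrable `[0%R, 1%R] (EFin \o F t).
  by move=> /inB[Bt _]; apply: unit_integrable => s s01; exact: segment_int_cont1.
have derF t s : `](- d), d[%classic t -> `[0%R, 1%R]%classic s -> derivable (F ^~ s) t 1.
  by move=> td; rewrite /= in_itv /= => s01; have [] := dF t s td s01.
have dFE t s : `](- d), d[%classic t -> 0 <= s <= 1 ->
    partial1of2 F t s = s ^+ k.+1 * g' (segment s (c t)).
  by move=> td s01; rewrite partial1of2E; have [] := dF t s td s01.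
have C10 : 0 <= C + 1 by rewrite addr_ge0.
have bndF t s : `](- d), d[%classic t -> `[0%R, 1%R]%classic s ->
    `|partial1of2 F t s| <= C + 1.
  move=> td; rewrite /= in_itv /= => s01; rewrite dFE //.
  have [_ /(_ s s01)] := inB t td; have := HC s s01.
  set u := _ * _; set v := _ * _ => uC uv.
  by rewrite -[v](subrK u) addrC (le_trans (ler_normD _ _)) // lerD // distrC.
have icst : mu.-integrable `[0%R, 1%R] (EFin \o (fun _ : R => C + 1)).
  by apply: unit_integrable => s _; exact: cst_continuous.
have mI : measurable (`[0%R, 1%R]%classic : set (measurableTypeR R)).
  exact: measurable_itv.
have der := derivable_under_integral mI I0 intF derF (fun _ => C10) icst bndF.
have derE := differentiation_under_integral mI I0 intF derF (fun _ => C10) icst bndF.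
apply: is_derive_line0; split; first exact: der.
rewrite -derive1E derE; apply: eq_Rintegral => s; rewrite inE /= in_itv /= => s01.
by rewrite dFE // c0.
Qed.

(** The weight [k] is generalised in the induction, because a partial derivative raises it by
    one. *)
Lemma Ck_segment_int n k g : Ck n B g -> Ck n B (segment_int k g).
Proof.
elim: n k g => [|n IH] k g Cg.
  split=> // x Bx; apply: segment_int_continuous => // y.
  exact: Ck_continuous Cg.
have Cg1 : Ck 1 B g by elim: n {IH} Cg => // n IHn /CkS; exact: IHn.
split=> [x Bx|i].
  apply: segment_int_continuous => // y; exact: Ck_continuous Cg.
split=> [x Bx|]; first by have [] := segment_int_partial k i Cg1 Bx.
apply: Ck_eq (IH k.+1 _ (Ck_partial i Cg)); first exact: ball_open.
by move=> x Bx; have [_ ->] := segment_int_partial k i Cg1 Bx.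
Qed.

End SegmentIntegral.

Section Hadamard.
Context {R : realType} {m : nat}.
Variables (a : 'rV[R]_m) (r : R).
Local Notation mu := (@lebesgue_measure R).
Local Notation B := (ball a r).
Implicit Types (g : 'rV[R]_m -> R) (x y : 'rV[R]_m).
Local Notation segment := (segment a).
Local Notation segment_int := (segment_int a).

Lemma segment1 x : segment 1 x = x.
Proof. by rewrite /segment scale1r subrK. Qed.

Lemma segment0 x : segment 0 x = a.
Proof. by rewrite /segment scale0r add0r. Qed.

(** At [x = a] the segment is constant, and the integral is that of a constant over [0, 1]. *)
Lemma segment_int_center g i : segment_int 0 (fun y => 'D_(delta_mx 0 i) g y) a =
  'D_(delta_mx 0 i) g a.
Proof.
rewrite /segment_int; under eq_Rintegral do
  rewrite expr0 mul1r /segment subrr scaler0 add0r.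
by rewrite Rintegral_cst //= lebesgue_measure_itv /= lte_fin ltr01 -EFinD subr0 /= mulr1.
Qed.

(** Integrate over [0, 1] the derivative of [g] along the segment from [a] to [x], expanded by the
    chain rule, and move the integral inside the sum. *)
Lemma hadamard g x : Ck 1 B g -> B x ->
  g x = g a + \sum_i (x 0 i - a 0 i) * segment_int 0 (fun y => 'D_(delta_mx 0 i) g y) x.
Proof.
move=> Cg Bx; pose D i y := 'D_(delta_mx 0 i) g y.
have cD i y : B y -> {for y, continuous (D i)}.
  exact: (Ck_continuous (Ck_partial i Cg)).
pose p s := g (segment s x); pose p' s := \sum_i (x - a) 0 i * D i (segment s x).
have dp (s : R) : 0 <= s <= 1 -> is_derive s 1 p (p' s).
  move=> s01; have Bs := segment_ball s01 Bx.
  have [dg dgE] := Ck_diff (@ball_open _ _ a r) Cg Bs.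
  have e1 : 'D_(x - a) g (segment s x) = p' s by rewrite deriveE // dgE.
  by rewrite -e1; apply: is_derive_line; exact: diff_derivable.
have cp (s : R) : 0 <= s <= 1 -> {for s, continuous p}.
  move=> s01; apply/differentiable_continuous/derivable1_diffP.
  by have [] := dp s s01.
have cDs i (s : R) : 0 <= s <= 1 -> {for s, continuous (fun s => D i (segment s x))}.
  move=> s01; have -> : (fun s => D i (segment s x)) = (fun s => s ^+ 0 * D i (segment s x)).
    by apply/funext => t; rewrite expr0 mul1r.
  by apply: (segment_int_cont1 (r := r)) => // y; exact: cD.
have cterm i (s : R) : 0 <= s <= 1 ->
    {for s, continuous (fun s => (x - a) 0 i * D i (segment s x))}.
  by move=> s01; apply: cvgM; [exact: cvg_cst|exact: cDs].
(* Here and in [lin] the sum runs over an arbitrary list, so that induction on the list applies. *)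
have csum (l : seq 'I_m) (s : R) : 0 <= s <= 1 ->
    {for s, continuous (fun s => \sum_(i <- l) (x - a) 0 i * D i (segment s x))}.
  move=> s01; rewrite /prop_for /continuous_at; elim: l => [|i l IH].
    by under eq_fun do rewrite big_nil; rewrite big_nil; exact: cvg_cst.
  under eq_fun do rewrite big_cons.
  by rewrite big_cons; apply: cvgD; [exact: cterm|exact: IH].
have FTC : \int[mu]_(s in `[0%R, 1%R]) p' s = g x - g a.
  rewrite /Rintegral (@continuous_FTC2 _ p' p 0 1) //=.
  - by rewrite /p segment1 segment0.
  - by apply: unit_within => s s01; exact: csum.
  - split.
    + move=> s; rewrite in_itv /= => /andP[s0 s1].
      by have [|] := dp s; rewrite ?ltW.
    + by apply: cvg_at_right_filter; apply: cp; rewrite lexx ler01.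
    + by apply: cvg_at_left_filter; apply: cp; rewrite lexx ler01.
  - move=> s; rewrite in_itv /= => /andP[s0 s1].
    by rewrite derive1E; have [|] := dp s; rewrite ?ltW.
have lin (l : seq 'I_m) :
    \int[mu]_(s in `[0%R, 1%R]) (\sum_(i <- l) (x - a) 0 i * D i (segment s x)) =
    \sum_(i <- l) (x 0 i - a 0 i) * segment_int 0 (D i) x.
  elim: l => [|i l IH].
    rewrite big_nil; under eq_Rintegral do rewrite big_nil.
    by rewrite Rintegral_cst // mul0r.
  rewrite big_cons -IH; under eq_Rintegral do rewrite big_cons.
  rewrite RintegralD //; last 2 first.
    by apply: unit_integrable => s s01; exact: cterm.
    by apply: unit_integrable => s s01; exact: csum.
  rewrite RintegralZl //; last by apply: unit_integrable => s s01; exact: cDs.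
  rewrite !mxE /segment_int; congr (_ * _ + _).
  by under [RHS]eq_Rintegral do rewrite expr0 mul1r.
by rewrite -lin FTC addrC subrK.
Qed.

End Hadamard.

(** * Tangent vectors in coordinates *)

Section Coordinates.
Context {R : realType} {m : nat} {N : manifold R m}.
Implicit Types (U : set N) (f : N -> R) (p : N) (c : chart R m N).

Lemma smooth_on_near U f : open U -> smooth_on U f ->
  forall p, U p -> smooth_near p f.
Proof. by move=> oU sf p Up; exists U. Qed.

Lemma smooth_on_local U f : (forall p, U p -> smooth_near p f) -> smooth_on U f.
Proof.
move=> loc c ac k; apply: Ck_local => _ [p [Up cp] <-].
have [W [oW Wp sf]] := loc p Up; exists (c @` (W `&` dom c)); split.
- exact: chart_image_open.
- by exists p.
- exact: sf.
Qed.

Lemma smooth_near_eq p f g : smooth_near p f ->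
  (\forall q \near p, f q = g q) -> smooth_near p g.
Proof.
move=> + efg; have : nbhs p [set q | f q = g q] by [].
rewrite nbhsE => -[W [oW Wp] fg] [U [oU Up sf]].
exists (U `&` W); split => //; first exact: openI.
apply: (smooth_on_eq (f := f)); first exact: openI.
  by move=> q [_ /fg].
by apply: smooth_on_sub sf => q [].
Qed.

Lemma smooth_near_sum p (I : Type) (l : seq I) (f : I -> N -> R) :
  (forall i, smooth_near p (f i)) ->
  smooth_near p (fun q => \sum_(i <- l) f i q).
Proof.
move=> sf; elim: l => [|i l IH].
  by under eq_fun do rewrite big_nil; exact: smooth_near_cst.
by under eq_fun do rewrite big_cons; exact: smooth_nearD.
Qed.

Lemma tangentD p (v : tangent p) f g : smooth_near p f -> smooth_near p g ->
  v (fun q => f q + g q) = v f + v g :> R.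
Proof.
have [_ v2 _] := tangent_derivation v; move=> sf sg.
have := v2 1 _ _ sf sg; rewrite mul1r => <-.
by congr (v _); apply/funext => q; rewrite mul1r.
Qed.

Lemma tangent_sum p (v : tangent p) (I : Type) (l : seq I) (f : I -> N -> R) :
  (forall i, smooth_near p (f i)) ->
  v (fun q => \sum_(i <- l) f i q) = \sum_(i <- l) v (f i) :> R.
Proof.
move=> sf; elim: l => [|i l IH].
  by rewrite big_nil; under eq_fun do rewrite big_nil; exact: tangent_cst.
rewrite big_cons -IH -tangentD //; last exact: smooth_near_sum.
by under eq_fun do rewrite big_cons.
Qed.

Lemma chart_preimage_open c (W : set 'rV[R]_m) : open W ->
  open (dom c `&` c @^-1` W).
Proof.
move=> oW; rewrite openE => p [cp Wp]; apply: filterI.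
  by apply: open_nbhs_nbhs; split => //; exact: dom_open.
by apply: (coord_cont cp); apply: open_nbhs_nbhs.
Qed.

(** Read in another chart [d], the function is [F] composed with the transition map from [d] to [c],
    which is smooth by compatibility of the atlas. *)
Lemma smooth_on_pullback c (W : set 'rV[R]_m) (F : 'rV[R]_m -> R) :
  atlas N c -> open W -> smooth_in W F ->
  smooth_on (dom c `&` c @^-1` W) (F \o c).
Proof.
move=> ac oW sF d ad k.
apply: (@Ck_comp _ _ _ k (c \o param d) _ W F) => //.
- by apply: chart_image_open; exact: chart_preimage_open.
- by move=> _ [p [[cp Wp] dp] <-] /=; rewrite coordK.
- move=> j; apply: Ck_sub (atlas_compat ad ac j k).
  by move=> _ [p [[cp _] dp] <-]; exists p.
Qed.

Lemma smooth_near_pullback c (W : set 'rV[R]_m) (F : 'rV[R]_m -> R) p :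
  atlas N c -> dom c p -> open W -> W (c p) -> smooth_in W F ->
  smooth_near p (F \o c).
Proof.
move=> ac cp oW Wp sF; exists (dom c `&` c @^-1` W); split => //.
  exact: chart_preimage_open.
exact: smooth_on_pullback.
Qed.

Lemma smooth_on_coord c i : atlas N c -> smooth_on (dom c) (fun p => c p 0 i).
Proof.
move=> ac; have := @smooth_on_pullback c setT (fun x => x 0 i) ac openT.
by rewrite preimage_setT setIT; apply => k; exact: Ck_coord.
Qed.

Lemma smooth_near_coord c p i : atlas N c -> dom c p ->
  smooth_near p (fun q => c q 0 i).
Proof. by move=> ac cp; exists (dom c); split; [exact: dom_open| |exact: smooth_on_coord]. Qed.

(** A derivation is evaluated on the Hadamard expansion of [f] at [p]. This is the step from
    abstract derivations to components. *)
Lemma tangent_coordE c p (v : tangent p) f :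
  atlas N c -> dom c p -> smooth_near p f ->
  v f = \sum_i v (fun q => c q 0 i) * 'D_(delta_mx 0 i) (f \o param c) (c p) :> R.
Proof.
move=> ac cp sf; have [U [oU Up sfU]] := sf.
set F := f \o param c; set a := c p.
have oO : open (c @` (U `&` dom c)) by exact: chart_image_open.
(* The image of the chart need not be star-shaped about [a], so the expansion is made on a ball
   inside it. *)
have /nbhs_ballP[r /= r0 rO] : nbhs a (c @` (U `&` dom c)).
  by apply: open_nbhs_nbhs; split => //; exists p.
pose W := ball a r; have oW : open W by exact: ball_open.
have Wa : W a by exact: ballxx.
have sF : smooth_in W F by move=> k; apply: Ck_sub rO (sfU c ac k).
pose H i := segment_int a 0 (fun y => 'D_(delta_mx 0 i) F y).
have sH i : smooth_near p (H i \o c).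
  apply: (smooth_near_pullback (W := W)) => // k; apply: Ck_segment_int.
  exact: Ck_partial (sF k.+1).
have sc i := smooth_near_coord i ac cp.
pose l i q := c q 0 i + - a 0 i.
have sl i : smooth_near p (l i) by apply: smooth_nearD => //; exact: smooth_near_cst.
have sterm i : smooth_near p (fun q => l i q * (H i \o c) q) by exact: smooth_nearM.
have fE : \forall q \near p, f q = F a + \sum_i l i q * (H i \o c) q.
  have nW : \forall q \near p, (dom c `&` c @^-1` W) q.
    by apply: open_nbhs_nbhs; split => //; exact: chart_preimage_open.
  apply: filterS nW => q [cq Wq].
  by rewrite -(hadamard (sF 1) Wq) /F /= coordK.
have [v1 v2 v3] := tangent_derivation v.
rewrite (v1 _ _ sf _ fE); last first.
  by apply: smooth_nearD; [exact: smooth_near_cst|exact: smooth_near_sum].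
rewrite tangentD; [|exact: smooth_near_cst|exact: smooth_near_sum].
rewrite tangent_cst add0r tangent_sum //; apply: eq_bigr => i _.
(* As [l i] vanishes at [p], Leibniz leaves only [v (l i)] times the value of [H i] at the centre,
   which is the partial derivative. *)
rewrite v3 // {1}/l subrr mul0r add0r /= [H i _]segment_int_center mulrC.
congr (_ * _); rewrite tangentD //; last exact: smooth_near_cst.
by rewrite tangent_cst addr0.
Qed.

Lemma tangent_eq_coord c p (v w : tangent p) : atlas N c -> dom c p ->
  (forall i, v (fun q => c q 0 i) = w (fun q => c q 0 i) :> R) -> v = w.
Proof.
move=> ac cp vw; apply: tangent_eq => f sf.
by rewrite !(tangent_coordE _ ac cp sf); apply: eq_bigr => i _; rewrite vw.
Qed.

End Coordinates.

(** * Lifted vector fields *)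

(** The two functions may live on different spaces. This compares derivatives along the line or
    along a slice with partial derivatives in a product chart. *)
Lemma eq_derive (R : realType) (V1 V2 : normedModType R) (f : V1 -> R) (g : V2 -> R)
    (a v : V1) (b w : V2) :
  (forall h : R, f (h *: v + a) = g (h *: w + b)) -> 'D_v f a = 'D_w g b.
Proof.
move=> fg; have fg0 : f a = g b by have := fg 0; rewrite !scale0r !add0r.
suff e : (fun h : R => h^-1 *: ((f \o shift a) (h *: v) - f a)) =
    (fun h : R => h^-1 *: ((g \o shift b) (h *: w) - g b)) by rewrite /derive e.
by apply/funext => h /=; rewrite fg fg0.
Qed.

Section SmoothFields.
Context {R : realType} {m : nat} {N : manifold R m}.
Implicit Types (f : N -> R) (p : N) (c : chart R m N) (X Y : vfield N).

Lemma smooth_vfieldP X :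
  (forall p f, smooth_near p f -> smooth_near p (act X f)) -> smooth_vfield X.
Proof.
move=> sX V f oV _ sf; apply: smooth_on_local => p Vp; apply: sX.
exact: smooth_on_near sf p Vp.
Qed.

Lemma smooth_near_nbhs p f : smooth_near p f -> \forall q \near p, smooth_near q f.
Proof.
move=> [U [oU Up sf]]; have : \forall q \near p, U q by exact: open_nbhs_nbhs.
by apply: filterS => q Uq; exists U.
Qed.

Lemma smooth_near_partial c p f i : atlas N c -> dom c p -> smooth_near p f ->
  smooth_near p (fun q => 'D_(delta_mx 0 i) (f \o param c) (c q)).
Proof.
move=> ac cp [U [oU Up sf]].
apply: (smooth_near_pullback (W := c @` (U `&` dom c))
  (F := fun x => 'D_(delta_mx 0 i) (f \o param c) x)) => //.
- exact: chart_image_open.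
- by exists p.
- by move=> k; apply: Ck_partial; exact: (sf c ac k.+1).
Qed.

Lemma smooth_vfieldD X Y : smooth_vfield X -> smooth_vfield Y ->
  smooth_vfield (fun p => X p + Y p).
Proof.
move=> sX sY; apply: smooth_vfieldP => p f sf.
exact: smooth_nearD (smooth_near_act sX sf) (smooth_near_act sY sf).
Qed.

Lemma smooth_vfieldN X : smooth_vfield X -> smooth_vfield (fun p => - X p).
Proof.
move=> sX; apply: smooth_vfieldP => p f sf.
have := smooth_nearZ (-1) (smooth_near_act sX sf).
by move/smooth_near_eq; apply; apply: nearW => q; rewrite mulN1r.
Qed.

(** Smoothness is asked of the known representative [g] only; [f] inherits it by having the same
    germ. *)
Lemma tangent_local p (v : tangent p) f g : smooth_near p g ->
  (\forall q \near p, g q = f q) -> v f = v g :> R.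
Proof.
move=> sg gf; have [v1 _ _] := tangent_derivation v.
by apply/esym/v1 => //; exact: smooth_near_eq sg gf.
Qed.

(** Metric compatibility expands the three derivatives, torsion-freeness the three brackets, and
    symmetry cancels all terms but one. The two algebraic hypotheses are those checked for the
    lifted metric in [g_lift_lin] and [g_lift_sym]. *)
Lemma koszul (g : tensor2 N) (D : vfield N -> vfield N -> vfield N) :
  (forall p a u v w, g p (a *: u + v) w = a * g p u w + g p v w) ->
  (forall p u v, g p u v = g p v u) -> levi_civita g D ->
  forall X Y Z, smooth_vfield X -> smooth_vfield Y -> smooth_vfield Z ->
  forall p, 2 * g p (D X Y p) (Z p) =
    X p (fun q => g q (Y q) (Z q)) + Y p (fun q => g q (X q) (Z q))
    - Z p (fun q => g q (X q) (Y q)) + g p (bracket X Y p) (Z p)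
    - g p (bracket X Z p) (Y p) - g p (bracket Y Z p) (X p).
Proof.
move=> glin gsym lc X Y Z sX sY sZ p.
have gB u v w : g p (u - v) w = g p u w - g p v w.
  by rewrite addrC -scaleN1r glin mulN1r addrC.
rewrite !(lc_metric lc) // -!(lc_torsion_free lc) // !gB.
rewrite (gsym p (Y p) (D X Z p)) (gsym p (X p) (D Y Z p)) (gsym p (X p) (D Z Y p)).
ring.
Qed.

End SmoothFields.

(** * Smoothness and brackets of lifts and of [xi] *)

Section LiftedFields.
Context {R : realType} {m : nat} {N : manifold R m}.
Notation M := (line_prod N).
Implicit Types (q : R * N) (f : M -> R) (h : N -> R) (X Y : vfield N).

Lemma line_partial (c : chart R m N) q f : dom c q.2 ->
  'D_1 (fun s : R => f (s, q.2)) q.1 =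
  'D_(delta_mx 0 (lshift m 0)) (f \o param (prod_chart c)) (prod_chart c q).
Proof.
move=> cp; apply: eq_derive => h /=.
rewrite /prod_param /prod_coord mxE row_mxEl !mxE !eqxx /= mulr1n; congr (f (_, _)).
rewrite linearD linearZ /= row_mxKr.
rewrite (_ : rsubmx _ = 0) ?scaler0 ?add0r ?coordK //.
by apply/rowP => i; rewrite !mxE eq_rlshift andbF.
Qed.

Lemma slice_partial (c : chart R m N) q f i : dom c q.2 ->
  'D_(delta_mx 0 i) ((fun p => f (q.1, p)) \o param c) (c q.2) =
  'D_(delta_mx 0 (rshift 1 i)) (f \o param (prod_chart c)) (prod_chart c q).
Proof.
move=> cp; apply: eq_derive => h /=.
rewrite /prod_param /prod_coord; congr (f (_, param c _)).
  by rewrite mxE row_mxEl !mxE eq_lrshift andbF mulr0 add0r mulr1n.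
rewrite linearD linearZ /= row_mxKr; congr (_ *: _ + _).
by apply/rowP => j; rewrite !mxE eq_rshift.
Qed.

Lemma prod_atlas (c : chart R m N) : atlas N c -> atlas M (prod_chart c).
Proof. by move=> ac; exists c. Qed.

Lemma near_snd q (P : N -> Prop) :
  (\forall p \near q.2, P p) -> \forall r \near (q : M), P (r : R * N).2.
Proof.
have c2 : {for q, continuous (snd : R * N -> N)} by exact: cvg_snd.
exact: (c2 [set p | P p]).
Qed.

(** In a product chart [xi] is the partial derivative in the first coordinate. *)
Lemma smooth_xi : smooth_vfield (xi (N := N)).
Proof.
apply: smooth_vfieldP => q f sf; have [c ac cp] := atlas_cover (q : R * N).2.
refine (smooth_near_eq
  (smooth_near_partial (lshift m 0) (prod_atlas ac) cp sf) _).
have nc := near_snd (q := q) (open_nbhs_nbhs (conj (dom_open c) cp)).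
apply: filterS2 nc (smooth_near_nbhs sf) => r cr sr.
by rewrite /act xiE // (line_partial _ cr).
Qed.

(** In a product chart the slice field is the sum of the functions [X c_i], pulled back from [N],
    times the partial derivatives in the coordinates of [N]; all of these are smooth. *)
Lemma smooth_slice X : smooth_vfield X ->
  smooth_vfield (N := M) (fun q => slice_vec (X (q : R * N).2)).
Proof.
move=> sX; apply: smooth_vfieldP => q f sf; have [c ac cp] := atlas_cover (q : R * N).2.
have sterm i : smooth_near (N := M) q (fun r => act X (fun p => c p 0 i) (r : R * N).2 *
    'D_(delta_mx 0 (rshift 1 i)) (f \o param (prod_chart c)) (prod_chart c r)).
  apply: smooth_nearM.
    by apply: smooth_near_snd; apply: smooth_near_act => //; exact: smooth_near_coord.
  exact: smooth_near_partial (prod_atlas ac) cp sf.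
refine (smooth_near_eq (smooth_near_sum (index_enum _) sterm) _).
have nc := near_snd (q := q) (open_nbhs_nbhs (conj (dom_open c) cp)).
apply: filterS2 nc (smooth_near_nbhs sf) => r cr sr.
rewrite /act slice_vecE // (tangent_coordE _ ac cr); last exact: smooth_near_slice.
by apply: eq_bigr => i _; rewrite slice_partial.
Qed.

Lemma smooth_push_slice (V : vfield M) (t : R) : smooth_vfield V ->
  smooth_vfield (fun p : N => push_snd (V (t, p))).
Proof.
move=> sV; apply: smooth_vfieldP => p h sh.
have sVh : smooth_near (N := M) (t, p) (act V (h \o snd)).
  by apply: smooth_near_act => //; exact: smooth_near_snd.
refine (smooth_near_eq (smooth_near_slice sVh) _).
by apply: filterS (smooth_near_nbhs sh) => r sr; rewrite /act push_sndE.
Qed.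

Variable tau : one_form N.

Lemma smooth_near_form X p : smooth_vfield X ->
  smooth_near p (fun r => tau r (X r)).
Proof.
move=> sX; exists setT; split => //; first exact: openT.
by apply: form_smooth => //; exact: openT.
Qed.

Lemma smooth_lift X : smooth_vfield X -> smooth_vfield (lift_field tau X).
Proof.
move=> sX; apply: smooth_vfieldP => q f sf.
have s1 := smooth_near_act (smooth_slice sX) sf.
have s2 : smooth_near (N := M) q (fun r => - 1 * tau (r : R * N).2 (X (r : R * N).2)).
  by apply: smooth_nearZ; exact: (smooth_near_snd (smooth_near_form _ sX)).
have := smooth_nearD s1 (smooth_nearM s2 (smooth_near_act smooth_xi sf)).
move/smooth_near_eq; apply; apply: (@filterE M (nbhs q)) => r.
by rewrite mulN1r mulNr.
Qed.

(** Equal projections make the [tau] parts of [eta] agree, hence also the values on [fst]. So all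
    coordinates of [V] and [W] in a product chart coincide. *)
Lemma tangent_eq_lift q (V W : tangent (N := M) q) :
  eta tau V = eta tau W -> push_snd V = push_snd W -> V = W.
Proof.
rewrite /eta => etaVW pVW; have VWfst : V fst = W fst :> R.
  by move: etaVW; rewrite pVW => /addIr.
have [c ac cp] := atlas_cover q.2.
apply: (tangent_eq_coord (prod_atlas ac)) => // i.
case: (splitP i) => j ij.
  have -> : i = lshift m j by exact/val_inj.
  have -> : (fun r => prod_chart c r 0 (lshift m j)) = fst :> (M -> R).
    by apply/funext => r; rewrite /= /prod_coord row_mxEl mxE ord1 eqxx mulr1n.
  exact: VWfst.
have -> : i = rshift 1 j by exact/val_inj.
have -> : (fun r => prod_chart c r 0 (rshift 1 j)) =
    (fun p => c p 0 j) \o snd :> (M -> R).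
  by apply/funext => r; rewrite /= /prod_coord row_mxEr.
by rewrite -!push_sndE ?pVW //; exact: smooth_near_coord.
Qed.

Lemma lift_snd X q h : smooth_near q.2 h ->
  lift_field tau X q (h \o snd) = X q.2 h :> R.
Proof. by move=> sh; rewrite -push_sndE // push_snd_lift. Qed.

Lemma lift_fst X q : lift_field tau X q fst = - tau q.2 (X q.2) :> R.
Proof.
have := eta_lift tau (X q.2 : tangent q.2); rewrite /eta push_snd_lift.
by move/eqP; rewrite addr_eq0 => /eqP.
Qed.

Lemma xi_snd q h : smooth_near q.2 h -> xi (N := N) q (h \o snd) = 0 :> R.
Proof. by move=> sh; rewrite -push_sndE // push_snd_xi. Qed.

Lemma xi_fst q : xi (N := N) q fst = 1 :> R.
Proof. by have := eta_xi tau q; rewrite /eta push_snd_xi linear0 addr0. Qed.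

Lemma act_lift_snd X q h : smooth_near q.2 h ->
  \forall r \near (q : M), (act X h \o snd) r = act (lift_field tau X) (h \o snd) r.
Proof.
move=> sh; apply: filterS (near_snd (smooth_near_nbhs sh)) => r sr.
by rewrite /act lift_snd.
Qed.

Lemma lift_lift_snd X Y q h : smooth_vfield X -> smooth_near q.2 h ->
  lift_field tau Y q (act (lift_field tau X) (h \o snd)) = Y q.2 (act X h) :> R.
Proof.
move=> sX sh; have sXh := smooth_near_act sX sh.
rewrite (tangent_local _ (smooth_near_snd sXh) (act_lift_snd X sh)).
exact: lift_snd.
Qed.

Lemma lift_lift_fst X Y q : smooth_vfield X ->
  lift_field tau Y q (act (lift_field tau X) fst) =
  - Y q.2 (fun p => tau p (X p)) :> R.
Proof.
move=> sX; have st := smooth_near_form q.2 sX.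
have -> : act (lift_field tau X) fst =
    (fun p => - 1 * tau p (X p)) \o snd :> (M -> R).
  by apply/funext => r; rewrite /act lift_fst /= mulN1r.
rewrite lift_snd; last exact: smooth_nearZ.
have [_ v2 _] := tangent_derivation (Y q.2).
have := v2 (-1) _ _ st (smooth_near_cst q.2 0).
rewrite tangent_cst addr0 mulN1r => <-.
by congr (Y q.2 _); apply/funext => p; rewrite addr0.
Qed.

(** A lift and its original field are related by the projection to [N], and so are their
    brackets. *)
Lemma push_bracket_lift X Y q : smooth_vfield X -> smooth_vfield Y ->
  push_snd (bracket (lift_field tau X) (lift_field tau Y) q) = bracket X Y q.2.
Proof.
move=> sX sY; apply: tangent_eq => h sh; rewrite push_sndE //.
rewrite !bracketE //; do ?[exact: smooth_lift|exact: smooth_near_snd].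
by rewrite !lift_lift_snd.
Qed.

(** Since [X^L] sends the coordinate t to [- tau X], the bracket sends t to
    [- X (tau Y) + Y (tau X)]; adding [tau [X, Y]] gives minus twice the exterior derivative in the
    present normalisation. *)
Lemma eta_bracket_lift X Y q : smooth_vfield X -> smooth_vfield Y ->
  eta tau (bracket (lift_field tau X) (lift_field tau Y) q) =
  - (2 * ext_d (fun r => tau r) X Y q.2).
Proof.
move=> sX sY; rewrite /eta push_bracket_lift // bracketE; last exact: smooth_near_fst.
  rewrite !lift_lift_fst // /ext_d mulrA mulfV ?mul1r ?pnatr_eq0 //.
  by ring.
all: exact: smooth_lift.
Qed.

(** On a function pulled back from [N] both terms of the bracket vanish: [xi] kills it, and [X^L]
    maps it to another such function. *)
Lemma push_bracket_lift_xi X q : smooth_vfield X ->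
  push_snd (bracket (lift_field tau X) (xi (N := N)) q) = 0.
Proof.
move=> sX; have sL := smooth_lift sX; apply: tangent_eq => h sh.
have sh' := smooth_near_snd sh.
rewrite push_sndE // bracketE //; last exact: smooth_xi.
have xi0 : \forall r \near (q : M), 0 = act (xi (N := N)) (h \o snd) r.
  by apply: filterS (near_snd (smooth_near_nbhs sh)) => r sr; rewrite /act xi_snd.
rewrite (tangent_local _ (smooth_near_cst _ 0) xi0) tangent_cst.
have sXh := smooth_near_act sX sh.
rewrite (tangent_local _ (smooth_near_snd sXh) (act_lift_snd X sh)).
by rewrite xi_snd // subr0.
Qed.

End LiftedFields.

(** * The connection of the lifted metric *)

Section LiftedMetric.
Context {R : realType} {m : nat} {N : manifold R m}.
Variables (tau : one_form N) (g : tensor2 N).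
Hypothesis rg : riemannian g.
Notation M := (line_prod N).
Implicit Types (q : R * N) (X Y Z : vfield N).

Lemma etaP q a (V W : tangent (N := M) q) :
  eta tau (a *: V + W) = a * eta tau V + eta tau W.
Proof.
rewrite /eta push_sndP linearP -[X in X + _ = _]/(a * V fst + W fst).
by rewrite -[a *: _]/(a * _); ring.
Qed.

Lemma etaN q (V : tangent (N := M) q) : eta tau (- V) = - eta tau V.
Proof.
have e0 : eta tau (0 : tangent (N := M) q) = 0.
  by have := etaP (-1) (0 : tangent (N := M) q) 0; rewrite scaler0 addr0 mulN1r addNr.
by rewrite -scaleN1r -[_ *: _]addr0 etaP e0 addr0 mulN1r.
Qed.

Lemma push_sndN q (V : tangent (N := M) q) : push_snd (- V) = - push_snd V.
Proof.
have p0 : push_snd (0 : tangent (N := M) q) = 0.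
  by have := push_sndP (-1) (0 : tangent (N := M) q) 0; rewrite scaler0 addr0 scaleN1r addNr.
by rewrite -scaleN1r -[_ *: _]addr0 push_sndP p0 addr0 scaleN1r.
Qed.

Lemma metric_eq p (u v : tangent p) : g (u - v) (u - v) = 0 -> u = v.
Proof.
move=> g0; apply/eqP; rewrite -subr_eq0; apply/negPn/negP => /(metric_pos rg).
by rewrite g0 ltxx.
Qed.

Lemma metricB p (u v w : tangent p) : g (u - v) w = g u w - g v w.
Proof. by rewrite addrC -scaleN1r (metric_lin rg) mulN1r addrC. Qed.

Lemma metric0 p (w : tangent p) : g 0 w = 0.
Proof. by rewrite -(subrr w) metricB subrr. Qed.

Lemma metricN p (u w : tangent p) : g (- u) w = - g u w.
Proof. by rewrite -sub0r metricB metric0 sub0r. Qed.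

Lemma smooth_near_metric X Y p : smooth_vfield X -> smooth_vfield Y ->
  smooth_near p (fun r => g (X r) (Y r)).
Proof.
move=> sX sY; exists setT; split => //; first exact: openT.
by apply: (metric_smooth rg) => //; exact: openT.
Qed.

Lemma g_lift_lin q a (u v w : tangent (N := M) q) :
  g_lift tau g _ (a *: u + v) w = a * g_lift tau g _ u w + g_lift tau g _ v w.
Proof. by rewrite /g_lift etaP push_sndP (metric_lin rg); ring. Qed.

Lemma g_lift_sym q (u v : tangent (N := M) q) :
  g_lift tau g _ u v = g_lift tau g _ v u.
Proof. by rewrite /g_lift mulrC (Defs.metric_sym rg). Qed.

Lemma g_lift_lift q (V : tangent (N := M) q) (w : tangent q.2) :
  g_lift tau g _ V (lift_vec tau w) = g (push_snd V) w.
Proof. by rewrite /g_lift eta_lift mulr0 add0r push_snd_lift. Qed.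

Lemma g_lift_xi q (V : tangent (N := M) q) : g_lift tau g _ V (xi q) = eta tau V.
Proof.
by rewrite /g_lift eta_xi mulr1 push_snd_xi (Defs.metric_sym rg) metric0 addr0.
Qed.

(** * Components of the covariant derivatives along lifts *)

Variables (D : vfield N -> vfield N -> vfield N) (Db : vfield M -> vfield M -> vfield M).
Hypotheses (lcD : levi_civita g D) (lcDb : levi_civita (g_lift tau g) Db).
Local Notation "X ^L" := (lift_field tau X) (at level 2, format "X ^L").

(** The values of the six terms enter as equations, so that each use of the Koszul formula only
    lists the lemmas computing them. *)
Lemma koszul_lift (A B C : vfield M) q (a b c ab ac bc : R) :
  smooth_vfield A -> smooth_vfield B -> smooth_vfield C ->
  A q (fun r => g_lift tau g _ (B r) (C r)) = a :> R ->
  B q (fun r => g_lift tau g _ (A r) (C r)) = b :> R ->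
  C q (fun r => g_lift tau g _ (A r) (B r)) = c :> R ->
  g_lift tau g _ (bracket A B q) (C q) = ab ->
  g_lift tau g _ (bracket A C q) (B q) = ac ->
  g_lift tau g _ (bracket B C q) (A q) = bc ->
  2 * g_lift tau g _ (Db A B q) (C q) = a + b - c + ab - ac - bc.
Proof.
move=> sA sB sC <- <- <- <- <- <-.
exact: (@koszul _ _ M _ _ g_lift_lin g_lift_sym lcDb).
Qed.

Lemma g_lift_fields X Y : (fun r => g_lift tau g _ (X^L r) (Y^L r)) =
  (fun p => g (X p) (Y p)) \o snd :> (M -> R).
Proof. by apply/funext => r; rewrite g_lift_lift push_snd_lift. Qed.

Lemma act_g_lift_xi q (V : tangent (N := M) q) X :
  V (fun r => g_lift tau g _ (X^L r) (xi r)) = 0 :> R.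
Proof.
rewrite -(tangent_cst V 0); congr (V _).
by apply/funext => r; rewrite g_lift_xi eta_lift.
Qed.

Lemma act_xi_g_lift q (V : tangent (N := M) q) X :
  V (fun r => g_lift tau g _ (xi r) (X^L r)) = 0 :> R.
Proof.
rewrite -(act_g_lift_xi V X); congr (V _).
by apply/funext => r; rewrite g_lift_sym.
Qed.

Section Derivatives.
Variables (X Y : vfield N).
Hypotheses (sX : smooth_vfield X) (sY : smooth_vfield Y).

Lemma xi_g_lift q : xi q (fun r => g_lift tau g _ (X^L r) (Y^L r)) = 0 :> R.
Proof. by rewrite g_lift_fields xi_snd //; exact: smooth_near_metric. Qed.

Lemma lift_g_lift Z q : lift_field tau Z q (fun r => g_lift tau g _ (X^L r) (Y^L r)) =
  Z q.2 (fun p => g (X p) (Y p)) :> R.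
Proof. by rewrite g_lift_fields lift_snd //; exact: smooth_near_metric. Qed.

Lemma g_bracket_lift Z q : g_lift tau g _ (bracket X^L Y^L q) (Z^L q) =
  g (bracket X Y q.2) (Z q.2).
Proof. by rewrite g_lift_lift push_bracket_lift. Qed.

Lemma g_bracket_lift_xi q : g_lift tau g _ (bracket X^L Y^L q) (xi q) =
  - (2 * ext_d (fun r => tau r) X Y q.2).
Proof. by rewrite g_lift_xi eta_bracket_lift. Qed.

Lemma g_bracket_xi_lift q : g_lift tau g _ (bracket X^L xi q) (Y^L q) = 0.
Proof. by rewrite g_lift_lift push_bracket_lift_xi // metric0. Qed.

End Derivatives.

(** Koszul against [xi]: the products of lifts with [xi] vanish, [xi] kills [g(X, Y)], and brackets
    with [xi] project to 0. Only the [eta] component of the bracket of the two lifts survives. *)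
Lemma eta_conn_lift X Y q : smooth_vfield X -> smooth_vfield Y ->
  eta tau (Db X^L Y^L q) = - ext_d (fun r => tau r) X Y q.2.
Proof.
move=> sX sY; have sXL := smooth_lift tau sX; have sYL := smooth_lift tau sY.
have := koszul_lift sXL sYL (smooth_xi (N := N))
  (act_g_lift_xi (X^L q) Y) (act_g_lift_xi (Y^L q) X) (xi_g_lift sX sY q)
  (g_bracket_lift_xi sX sY q) (g_bracket_xi_lift Y sX q) (g_bracket_xi_lift X sY q).
by rewrite g_lift_xi; lra.
Qed.

(** Koszul against [Z^L]: each of the six terms equals the corresponding term of the Koszul formula
    on [N]. *)
Lemma push_conn_lift X Y Z q :
  smooth_vfield X -> smooth_vfield Y -> smooth_vfield Z ->
  g (push_snd (Db X^L Y^L q)) (Z q.2) = g (D X Y q.2) (Z q.2).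
Proof.
move=> sX sY sZ; have sXL := smooth_lift tau sX; have sYL := smooth_lift tau sY.
have := koszul_lift sXL sYL (smooth_lift tau sZ)
  (lift_g_lift sY sZ X q) (lift_g_lift sX sZ Y q) (lift_g_lift sX sY Z q)
  (g_bracket_lift sX sY Z q) (g_bracket_lift sX sZ Y q) (g_bracket_lift sY sZ X q).
rewrite -(koszul (metric_lin rg) (Defs.metric_sym rg) lcD sX sY sZ q.2).
rewrite (g_lift_lift (Db X^L Y^L q) (Z q.2)) => /mulfI; apply.
by rewrite pnatr_eq0.
Qed.

(** [xi] has constant length 1, so its derivative is orthogonal to it. *)
Lemma eta_conn_xi X q : smooth_vfield X -> eta tau (Db X^L xi q) = 0.
Proof.
move=> sX; have sXL := smooth_lift tau sX; have sxi := smooth_xi (N := N).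
have := lc_metric lcDb sXL sxi sxi q.
rewrite (_ : X^L q _ = 0 :> R); last first.
  rewrite -(tangent_cst (X^L q) 1); congr (X^L q _).
  by apply/funext => r; rewrite g_lift_xi eta_xi.
by rewrite (g_lift_sym (xi q) (Db X^L xi q)) (g_lift_xi (Db X^L xi q)); lra.
Qed.

(* Compatibility with g^L reduces this to the eta component of nablabar_{X^L} Z^L. *)
Lemma push_conn_xi X Z q : smooth_vfield X -> smooth_vfield Z ->
  g (push_snd (Db X^L xi q)) (Z q.2) = ext_d (fun r => tau r) X Z q.2.
Proof.
move=> sX sZ; have sXL := smooth_lift tau sX; have sZL := smooth_lift tau sZ.
have sxi := smooth_xi (N := N).
have := lc_metric lcDb sXL sxi sZL q.
rewrite (act_xi_g_lift (X^L q) Z) (g_lift_lift (Db X^L xi q) (Z q.2)).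
rewrite (g_lift_sym (xi q) (Db X^L Z^L q)) (g_lift_xi (Db X^L Z^L q)).
by rewrite (eta_conn_lift q sX sZ); lra.
Qed.

End LiftedMetric.

Theorem proposition3 (R : realType) (n : nat) (N : manifold R (n + n))
    (J : endo_field N) (g : tensor2 N) (tau : one_form N)
    (nabla : vfield N -> vfield N -> vfield N)
    (nablabar : vfield (line_prod N) -> vfield (line_prod N) ->
                vfield (line_prod N)) :
  hausdorff_space N -> @second_countable N ->
  kaehler J g ->
  (forall X Y : vfield N, smooth_vfield X -> smooth_vfield Y -> forall p : N,
    fundamental_form g (fun r => J r) p (X p) (Y p) =
    ext_d (fun r => tau r) X Y p) ->
  levi_civita g nabla ->
  levi_civita (g_lift tau g) nablabar ->
  forall X Y : vfield N, smooth_vfield X -> smooth_vfield Y ->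
  forall q : line_prod N,
  [/\ nablabar (lift_field tau X) xi q =
         - phi tau J q (lift_field tau X q),
      - phi tau J q (lift_field tau X q) =
         - lift_field tau (fun p => J p (X p)) q
    & nablabar (lift_field tau X) (lift_field tau Y) q =
         lift_field tau (nabla X Y) q -
         fundamental_form (g_lift tau g) (phi tau J) q
           (lift_field tau X q) (lift_field tau Y q) *: xi q].
Proof.
move=> _ _ [J2 _ rg hJ _] dtau lcD lcDb X Y sX sY [t p].
have gN u v : g p u (- v) = - g p u v.
  by rewrite (Defs.metric_sym rg) (metricN rg) (Defs.metric_sym rg).
have sJ (Z : vfield N) : smooth_vfield Z -> smooth_vfield (fun r => J r (Z r)).
  by move=> sZ; apply: endo_smooth => //; exact: openT.
have sXL := smooth_lift tau sX; have sYL := smooth_lift tau sY.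
have phiE (Z : vfield N) : phi tau J (t, p) (lift_field tau Z (t, p)) =
    lift_field tau (fun r => J r (Z r)) (t, p) by exact: phi_lift.
have PhiE : fundamental_form (g_lift tau g) (phi tau J) (t, p)
    (lift_field tau X (t, p)) (lift_field tau Y (t, p)) = g p (X p) (J p (Y p)).
  rewrite /fundamental_form (phiE Y) (g_lift_lift tau g (lift_field tau X (t, p))).
  by rewrite push_snd_lift.
have push_lift (Z : vfield N) : push_snd (lift_field tau Z (t, p)) = Z p.
  exact: push_snd_lift.
have eta_lift_field (Z : vfield N) : eta tau (lift_field tau Z (t, p)) = 0.
  exact: eta_lift.
split; first 2 last.
- apply: (tangent_eq_lift (tau := tau)).
    rewrite (eta_conn_lift rg lcDb _ sX sY) PhiE.
    rewrite [lift_field _ _ _ - _]addrC -(scaleNr _ (xi _)) etaP eta_xi.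
    by rewrite eta_lift_field addr0 mulr1 -(dtau X Y sX sY).
  rewrite [lift_field _ _ _ - _]addrC -(scaleNr _ (xi _)) push_sndP.
  rewrite push_snd_xi scaler0 add0r push_lift.
  (* The value of [Z] at [p] is the difference to be shown zero. As [t] is fixed, [Z] is a smooth
     field on [N] and may be used as test field in [push_conn_lift]. *)
  pose Z (r : N) :=
    push_snd (nablabar (lift_field tau X) (lift_field tau Y) (t, r)) - nabla X Y r.
  have sZ : smooth_vfield Z.
    apply: smooth_vfieldD; first by apply: smooth_push_slice; exact: (lc_smooth lcDb).
    by apply: smooth_vfieldN; exact: (lc_smooth lcD).
  apply: (metric_eq rg).
  by rewrite (metricB rg) (push_conn_lift rg lcD lcDb (t, p) sX sY sZ) subrr.
- rewrite phiE; apply: (tangent_eq_lift (tau := tau)).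
    by rewrite (eta_conn_xi rg lcDb _ sX) etaN eta_lift_field oppr0.
  rewrite push_sndN push_lift.
  (* The same device, with [- J X] as the expected projection. *)
  pose Z (r : N) := push_snd (nablabar (lift_field tau X) xi (t, r)) - - J r (X r).
  have sZ : smooth_vfield Z.
    apply: smooth_vfieldD.
      by apply: smooth_push_slice; apply: (lc_smooth lcDb) => //; exact: smooth_xi.
    by do 2![apply: smooth_vfieldN]; exact: sJ.
  apply: (metric_eq rg).
  rewrite (metricB rg) (push_conn_xi rg lcDb (t, p) sX sZ) -(dtau X Z sX sZ).
  (* Since [J] is an isometry with square -1, [g(X, J Z) = g(J X, J J Z) = - g(J X, Z)]. *)
  by rewrite (metricN rg) /fundamental_form -(hJ p (X p)) J2 gN subrr.
- by rewrite phiE.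
Qed.
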